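(* Let $\delta>0$, $s>1$, and let $\eta_\pm,u_\pm\in\mathbb{R}$ satisfy $\eta_->\eta_+>-1$, $u_->u_+$, the shock relations $$s=\frac{(1+\eta_-)u_--(1+\eta_+)u_+}{\eta_--\eta_+},\qquad s=\frac{\eta_-+\tfrac12u_-^2-\eta_+-\tfrac12u_+^2}{u_--u_+},$$ and the Lax condition $u_++\sqrt{1+\eta_+}<s<u_-+\sqrt{1+\eta_-}$. Let $C=(1+\eta_+)(u_+-s)$ and $\eta_*=\sqrt[3]{C^2}-1$. Then there exist a left half-orbit $\eta_L:(-\infty,0)\to(\eta_*,\eta_-)$ and a right half-orbit $\eta_R:(0,\infty)\to(\eta_+,\eta_* )$ of the profile equation (both notions are defined in the context): $(\eta_L,\eta_L')\to(\eta_-,0)$ as $\xi\to-\infty$, $(\eta_R,\eta_R')\to(\eta_+,0)$ as $\xi\to+\infty$, and $\eta_L(\xi)\to\eta_*$ as $\xi\to0^-$, $\eta_R(\xi)\to\eta_*$ as $\xi\to0^+$. Moreover, if $\eta:\mathbb{R}\to\mathbb{R}$ is the glued profile, equal to $\eta_L$ on $(-\infty,0)$, to $\eta_R$ on $(0,\infty)$, with $\eta(0)=\eta_*$, and $u=s+\frac{C}{1+\eta}$, then $(\eta,u)$ is a weakly singular traveling-wave solution (as defined in the context) with speed $s$ and asymptotic states $\eta_\pm,u_\pm$.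
   Context: The underlying system is the regularized shallow water system, with $\delta>0$: $$\eta_t+[(1+\eta)u]_x=0,\qquad u_t+\eta_x+uu_x-\delta[\eta_{xxx}+u_{xxt}+uu_{xxx}]=0,$$ and traveling waves are functions of $\xi=x-st$; a prime denotes $d/d\xi$. Profile equation. With $C=(1+\eta_+)(u_+-s)$ and $\sigma=\dfrac{2\eta_++(s-u_+)^2}{(1+\eta_+)^2(s-u_+)^2}$, the profile equation is $$\delta\eta''=\eta+\frac{C^2}{2(C^2-(1+\eta)^3)}\left[\sigma(1+\eta)^3-(1+3\eta)+3\delta\frac{(\eta')^2}{1+\eta}\right],$$ which is singular at $\eta=\eta_*:=\sqrt[3]{C^2}-1$. (Under the Lax condition $\eta_+<\eta_*<\eta_-$.) Half-orbits. A left half-orbit is a $C^2$ classical solution $\eta:(-\infty,0)\to(\eta_*,\eta_-)$ of the profile equation with $\eta'<0$, $\eta\to\eta_-$ and $\eta'\to0$ as $\xi\to-\infty$, and $\eta\to\eta_*$ as $\xi\to0^-$. A right half-orbit is a $C^2$ classical solution $\eta:(0,\infty)\to(\eta_+,\eta_* )$ with $\eta'<0$, $\eta\to\eta_+$ and $\eta'\to0$ as $\xi\to+\infty$, and $\eta\to\eta_*$ as $\xi\to0^+$. Definition (weakly singular traveling-wave solution). Let $s>1$ and let $\eta_\pm,u_\pm$ satisfy the shock relations and the Lax condition. A pair of continuous functions $(\eta,u)\in C(\mathbb{R})^2$ is a weakly singular traveling-wave solution with speed $s$ and asymptotic states $\eta_\pm,u_\pm$ if (i) $\eta\to\eta_\pm$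 and $u\to u_\pm$ as $\xi\to\pm\infty$; (ii) the distributional derivatives satisfy $\eta',u'\in L^2_{\mathrm{loc}}(\mathbb{R})$; (iii) with $P:=\eta+\tfrac12(u-s)^2$, the identities $$-s\eta'+[(1+\eta)u]'=0\quad\text{and}\quad\left[P-\delta P''+\tfrac32\delta(u')^2\right]'=0$$ hold in the space of distributions $\mathcal{D}'(\mathbb{R})$. (Condition (iii) is the meaning given to ''$(\eta(x-st),u(x-st))$ solves the regularized system in the sense of distributions'': the term $\eta_{xxx}+u_{xxt}+uu_{xxx}$ is interpreted as $[P''-\tfrac32(u')^2]'$ evaluated at $x-st$.) *)

(* Defs.v *)
From HB Require Import structures.
From mathcomp Require Import all_boot all_order all_algebra.
From mathcomp Require Import all_classical all_reals all_analysis.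

Set Implicit Arguments.
Unset Strict Implicit.
Unset Printing Implicit Defensive.

Import Order.TTheory GRing.Theory Num.Theory.
Import numFieldNormedType.Exports.

Local Open Scope ring_scope.
Local Open Scope classical_set_scope.

(** * The shallow water shock

    [hm, um] is the state at -oo, [hp, up] the state at +oo
    (eta_-, u_-, eta_+, u_+). *)

Definition shock_relations (R : realType) (s hm hp um up : R) : Prop :=
  s = ((1 + hm) * um - (1 + hp) * up) / (hm - hp) /\
  s = (hm + 2^-1 * um ^+ 2 - hp - 2^-1 * up ^+ 2) / (um - up).

Definition lax_condition (R : realType) (s hm hp um up : R) : Prop :=
  up + Num.sqrt (1 + hp) < s < um + Num.sqrt (1 + hm).

(** * The profile equation *)

Definition mass_flux (R : realType) (s hp up : R) : R := (1 + hp) * (up - s).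

Definition eta_star (R : realType) (s hp up : R) : R :=
  (mass_flux s hp up ^+ 2) `^ (3^-1) - 1.

Definition sigma_coef (R : realType) (s hp up : R) : R :=
  (2 * hp + (s - up) ^+ 2) / ((1 + hp) ^+ 2 * (s - up) ^+ 2).

Definition profile_equation_at (R : realType) (delta s hp up : R)
    (eta : R -> R) (xi : R) : Prop :=
  let C := mass_flux s hp up in
  delta * eta^`(2)%classic xi =
    eta xi
    + C ^+ 2 / (2 * (C ^+ 2 - (1 + eta xi) ^+ 3))
      * (sigma_coef s hp up * (1 + eta xi) ^+ 3 - (1 + 3 * eta xi)
         + 3 * delta * ((eta^`()%classic xi) ^+ 2 / (1 + eta xi))).

(* Functions on an open set [D] are represented by total functions; only their
   values on [D] matter, since derivatives at points of [D] are local. *)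
Definition C2_on (R : realType) (D : set R) (f : R -> R) : Prop :=
  forall x, D x ->
    [/\ derivable f x 1, derivable f^`() x 1 & {for x, continuous f^`(2)}].

Record left_half_orbit (R : realType) (delta s hm hp up : R) (eta : R -> R)
    : Prop := LeftHalfOrbit {
  lho_C2 : C2_on [set x | x < 0] eta ;
  lho_range : forall xi, xi < 0 -> eta_star s hp up < eta xi < hm ;
  lho_eq : forall xi, xi < 0 -> profile_equation_at delta s hp up eta xi ;
  lho_decr : forall xi, xi < 0 -> eta^`() xi < 0 ;
  lho_far : eta xi @[xi --> -oo] --> hm ;
  lho_far' : eta^`() xi @[xi --> -oo] --> (0 : R) ;
  lho_0 : eta xi @[xi --> 0^'-] --> eta_star s hp up }.

Record right_half_orbit (R : realType) (delta s hp up : R) (eta : R -> R)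
    : Prop := RightHalfOrbit {
  rho_C2 : C2_on [set x | 0 < x] eta ;
  rho_range : forall xi, 0 < xi -> hp < eta xi < eta_star s hp up ;
  rho_eq : forall xi, 0 < xi -> profile_equation_at delta s hp up eta xi ;
  rho_decr : forall xi, 0 < xi -> eta^`() xi < 0 ;
  rho_far : eta xi @[xi --> +oo] --> hp ;
  rho_far' : eta^`() xi @[xi --> +oo] --> (0 : R) ;
  rho_0 : eta xi @[xi --> 0^'+] --> eta_star s hp up }.

(** * Distributions on the real line

    A distribution is represented by its values on test functions. The ones
    used below are all linear combinations of derivatives of distributions
    [distr f] with [f] locally integrable, hence linear and continuous on the
    space of test functions, so continuity is not part of the type. Functionals
    are compared on test functions only (their values elsewhere are junk). *)

Definition test_function (R : realType) (phi : R -> R) : Prop :=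
  (forall (n : nat) (x : R), derivable phi^`(n) x 1) /\
  compact (closure [set x | phi x != 0]).

Definition functional (R : realType) : Type := (R -> R) -> R.

(* The regular distribution of a locally integrable [f]. *)
Definition distr (R : realType) (f : R -> R) : functional R :=
  fun phi => \int[lebesgue_measure]_(x in setT) (f x * phi x).

Definition distr_deriv (R : realType) (T : functional R) : functional R :=
  fun phi => - T phi^`()%classic.

Definition distr_eq (R : realType) (T1 T2 : functional R) : Prop :=
  forall phi, test_function phi -> T1 phi = T2 phi.

Definition distr_add (R : realType) (T1 T2 : functional R) : functional R :=
  fun phi => T1 phi + T2 phi.

Definition distr_scale (R : realType) (c : R) (T : functional R)
    : functional R :=
  fun phi => c * T phi.

Definition L2_loc (R : realType) (f : R -> R) : Prop :=
  measurable_fun setT f /\ locally_integrable setT (fun x => f x ^+ 2).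

(** * Weakly singular traveling waves *)

(* [deta] and [du] are representatives of the distributional derivatives of
   [eta] and [u]. They are unique almost everywhere, so that the distribution
   of [du ^+ 2] does not depend on the choice. *)
Definition weakly_singular_traveling_wave (R : realType)
    (delta s hm hp um up : R) (eta u : R -> R) : Prop :=
  [/\ continuous eta /\ continuous u,
      [/\ eta xi @[xi --> -oo] --> hm, eta xi @[xi --> +oo] --> hp,
          u xi @[xi --> -oo] --> um & u xi @[xi --> +oo] --> up] &
      exists deta du : R -> R,
        [/\ L2_loc deta /\ distr_eq (distr_deriv (distr eta)) (distr deta),
            L2_loc du /\ distr_eq (distr_deriv (distr u)) (distr du),
            distr_eq
              (distr_add (distr_scale (- s) (distr_deriv (distr eta)))
                 (distr_deriv (distr (fun x => (1 + eta x) * u x))))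
              (distr (fun=> 0)) &
            let P x := eta x + 2^-1 * (u x - s) ^+ 2 in
            distr_eq
              (distr_deriv
                 (distr_add
                    (distr_add (distr P)
                       (distr_scale (- delta)
                          (distr_deriv (distr_deriv (distr P)))))
                    (distr_scale (3 / 2 * delta)
                       (distr (fun x => du x ^+ 2)))))
              (distr (fun=> 0))]].

(* Main.v *)
Require Import Defs.
From mathcomp Require Import all_boot all_order all_algebra.
From mathcomp Require Import all_classical all_reals all_analysis.
From mathcomp Require Import ring lra measurable_realfun.

(** Write [h = 1 + eta], [c = 1 + eta_*] (so that [c^3 = C^2]), and let [b] be
    the asymptotic value of [h] at one end. Multiplying the momentum balance
    [P - P_b = delta [(1 - c^3/h^3) h'' + 3/2 (c^3/h^4) h'^2]] by [h'] makes it
    exact, which gives the first integral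
    [h'^2 = (h - b)^2 h^2 (h - c^3/b^2) / (delta (h^3 - c^3))].
    Each half-orbit is thus obtained by inverting a quadrature, which converges
    at [h = c] and diverges logarithmically at [h = b].

    At [xi = 0] the slope [h'] blows up, but the flux
    [P' = (1 - c^3/h^3) h'] tends to [0]. Hence [P'] is continuous, and
    [P'' = (P - P_b) / delta + 3/2 u'^2] off [0] is bounded below with a
    continuous antiderivative, so it is locally integrable. This gives at once
    that [u'] and [eta'] are locally square integrable and that [P''] has no
    singular part at [0]. *)

Set Implicit Arguments.
Unset Strict Implicit.
Unset Printing Implicit Defensive.

Import Order.TTheory GRing.Theory Num.Theory.
Import numFieldNormedType.Exports.

Local Open Scope classical_set_scope.
Local Open Scope ring_scope.

(** * Autonomous equations *)

Lemma is_derive1_continuous (R : realType) (f : R -> R) (x l : R) :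
  is_derive x 1 f l -> {for x, continuous f}.
Proof. by move=> [df _]; exact/differentiable_continuous/derivable1_diffP. Qed.

(** The integral starts at a point strictly between [a] and [c], which makes [c] interior, so that
    the derivative at [c] is two-sided. *)
Lemma continuous_antiderivative (R : realType) (f : R -> R) (a b c : R) :
  a < c < b -> (forall x, a < x < b -> {for x, continuous f}) ->
  exists2 F : R -> R, F c = 0 &
    forall x, c <= x < b -> is_derive x 1 F (f x).
Proof.
move=> /andP[ac cb] cf; pose a' := (a + c) / 2.
have [aa' a'c] : a < a' /\ a' < c by rewrite /a'; lra.
pose F0 x := \int[lebesgue_measure]_(t in `[a', x]) f t.
exists (fun x => F0 x - F0 c); first by rewrite subrr.
move=> x /andP[cx xb]; pose u := (x + b) / 2.
have [xu ub] : x < u /\ u < b by rewrite /u; lra.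
have fi : lebesgue_measure.-integrable `[a', u] (EFin \o f).
  apply: continuous_compact_integrable; first exact: segment_compact.
  apply: continuous_in_subspaceT => y; rewrite inE/= in_itv/= => /andP[? ?].
  by apply: cf; lra.
have [||dF F'] := @continuous_FTC1_closed R f a' x u xu fi.
- by lra.
- by apply: cf; lra.
have HF : is_derive x 1 F0 (f x) by apply: (DeriveDef dF); rewrite -derive1E; exact: F'.
rewrite -[f x]subr0; exact: is_deriveB.
Qed.

Lemma pos_derive_lt (R : realType) (f df : R -> R) (a b : R) : a < b ->
  (forall x, a <= x <= b -> is_derive x 1 f (df x)) ->
  (forall x, a < x < b -> 0 < df x) -> f a < f b.
Proof.
move=> ab fd dfp.
have [||x xab E] := @MVT R f df a b ab.
- by move=> x; rewrite in_itv/= => /andP[? ?]; apply: fd; lra.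
- apply: continuous_in_subspaceT => y; rewrite inE/= in_itv/= => yab.
  exact/is_derive1_continuous/fd.
by rewrite -subr_gt0 E mulr_gt0 ?subr_gt0// dfp// -[_ && _]/(x \in `]a, b[).
Qed.

(** Separation of variables: the time [T] needed to reach a point from [c] is a primitive of
    [q x / (b - x)], and the solution is its inverse. [T] is infinite at [b] because [0 < q b], and
    finite at [c] because [q] is continuous there. Positivity of [q] is asked only beyond [c], so
    the slope of [y] may blow up at [0]. *)
Lemma autonomous_ode (R : realType) (q : R -> R) (a b c : R) : a < c < b ->
  (forall x, a < x <= b -> {for x, continuous q}) ->
  (forall x, c < x <= b -> 0 < q x) ->
  exists y : R -> R,
    [/\ forall x : R, 0 < x -> c < y x < b,
        forall x : R, 0 < x -> is_derive x 1 y ((b - y x) / q (y x)),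
        y x @[x --> 0^'+] --> c & y x @[x --> +oo] --> b].
Proof.
move=> /andP[ac cb] cq q0.
have [||T Tc dT] :=
  @continuous_antiderivative R (fun x => q x / (b - x)) a b c.
- by rewrite ac.
- move=> x /andP[ax xb]; apply: cvgM; first by apply: cq; rewrite ax ltW.
  by apply: cvgV; [rewrite subr_eq0; lra|apply: cvgB; [exact: cvg_cst|exact: cvg_id]].
have Tlt x y : c <= x -> x < y -> y < b -> T x < T y.
  move=> cx xy yb; apply: (@pos_derive_lt _ _ (fun x => q x / (b - x))) => //.
    by move=> z /andP[? ?]; apply: dT; lra.
  by move=> z /andP[? ?]; apply: divr_gt0; [apply: q0|]; lra.
have Tltr x y : c <= y -> x < b -> T x < T y -> x < y.
  move=> cy xb Txy; rewrite ltNge; apply/negP; rewrite le_eqVlt.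
  by move=> /predU1P[E|yx]; [by move: Txy; rewrite E ltxx|have := Tlt _ _ cy yx xb; lra].
have Tinj x y : c <= x < b -> c <= y < b -> T x = T y -> x = y.
  move=> /andP[? ?] /andP[? ?] E.
  by case: (ltgtP x y) => // xy;
    [have : T x < T y by exact: Tlt|have : T y < T x by exact: Tlt];
    rewrite E ltxx.
(* [T] gains at least [k / 2] each time the distance to [b] is halved. *)
have Tinfty X : exists2 z, c < z < b & X < T z.
  pose k := q b / 2.
  have qb0 : 0 < q b by apply: q0; lra.
  have : \forall x \near b, k < q x.
    have /cvgr_gt : q x @[x --> b] --> q b by apply: cq; lra.
    by apply; rewrite /k; lra.
  move=> /nbhs_ballP[e /= e0 He].
  pose d := Num.min (e / 2) ((b - c) / 2).
  have d0 : 0 < d by rewrite /d lt_min; lra.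
  have [de dbc] : d <= e / 2 /\ d <= (b - c) / 2.
    by split; rewrite /d ge_min lexx ?orbT.
  have halve x : 0 < x <= d -> k / 2 <= T (b - x / 2) - T (b - x).
    move=> /andP[x0 xd].
    have [|||z] := @MVT R T (fun x => q x / (b - x)) (b - x) (b - x / 2).
    - lra.
    - by move=> z; rewrite in_itv/= => /andP[? ?]; apply: dT; lra.
    - apply: continuous_in_subspaceT => y; rewrite inE/= in_itv/= => /andP[? ?].
      by apply: is_derive1_continuous; apply: dT; lra.
    rewrite in_itv/= => /andP[zl zr] ->.
    have kq : k < q z by apply: He; rewrite /ball/= ger0_norm; lra.
    rewrite [X in _ <= _ * X](_ : _ = x / 2); last lra.
    rewrite [leRHS]mulrAC ler_pdivlMr; last lra.
    have := ltW kq; have : 0 < k by rewrite /k; lra.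
    nra.
  have Tn n : n%:R * (k / 2) <= T (b - d / 2 ^+ n) - T (b - d).
    elim: n => [|n IHn]; first by rewrite mul0r expr0 divr1 subrr.
    have dn : 0 < d / 2 ^+ n <= d.
      rewrite divr_gt0 ?exprn_gt0//= ler_pdivrMr ?exprn_gt0//.
      by rewrite ler_peMr ?(ltW d0)// exprn_ege1// ler1n.
    have := halve _ dn.
    have -> : d / 2 ^+ n / 2 = d / 2 ^+ n.+1 by rewrite exprSr invfM mulrA.
    have -> : n.+1%:R = n%:R + 1 :> R by rewrite natr1.
    by move=> *; lra.
  have k0 : 0 < k / 2 by rewrite /k; lra.
  pose n := (Num.truncn ((X - T (b - d)) / (k / 2))).+1.
  have Hn : X - T (b - d) < n%:R * (k / 2).
    by rewrite -ltr_pdivrMr// /n truncnS_gt.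
  exists (b - d / 2 ^+ n); last by have := Tn n; lra.
  have : 0 < d / 2 ^+ n <= d.
    rewrite divr_gt0 ?exprn_gt0//= ler_pdivrMr ?exprn_gt0//.
    by rewrite ler_peMr ?(ltW d0)// exprn_ege1// ler1n.
  by move=> /andP[? ?]; lra.
(* The premise [0 < x] sits under the existential, so that choice yields a total function; its
   values at [x <= 0] are arbitrary. *)
have /choice[y yP] : forall x, exists z, 0 < x -> c < z < b /\ T z = x.
  move=> x; have [x0|] := ltP 0 x; last by exists 0; lra.
  have [M /andP[cM Mb] xM] := Tinfty x.
  have [|||z] := @IVT R T c M x.
  - exact: ltW.
  - apply: continuous_in_subspaceT => z; rewrite inE/= in_itv/= => /andP[? ?].
    by apply: is_derive1_continuous; apply: dT; lra.
  - by rewrite Tc ge_min le_max (ltW x0) (ltW xM) orbT.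
  rewrite in_itv/= => /andP[cz zM] Tz; exists z => _; split => //.
  rewrite (le_lt_trans zM Mb) andbT lt_neqAle cz andbT.
  by apply/eqP => E; move: Tz x0; rewrite -E Tc => <-; rewrite ltxx.
have T0 z : c < z < b -> 0 < T z.
  by move=> /andP[cz zb]; rewrite -Tc; exact: Tlt.
exists y; split.
- by move=> x /yP[].
- move=> x x0; have [yb Tyx] := yP x x0; have /andP[cy yb'] := yb.
  have near_y : \forall z \near y x, c < z < b.
    by near=> z; apply/andP; split; near: z; [exact: lt_nbhsr|exact: lt_nbhsl].
  (* Writing the base point as [T (y x)] and the slope as an inverse gives the form of the inverse
     function rule. *)
  rewrite -[in is_derive _]Tyx.
  rewrite -[_ / _]invrK invf_div.
  apply: (@is_derive_inverse R T y (q (y x) / (b - y x))).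
  + near=> z; have /T0 Tz0 : c < z < b by near: z.
    have [? ?] := yP _ Tz0; apply: Tinj => //; first lra.
    by near: z; move: near_y; apply: filterS => z; lra.
  + near=> z; apply: is_derive1_continuous; apply: dT.
    by near: z; move: near_y; apply: filterS => z; lra.
  + by apply: dT; lra.
  + by rewrite gt_eqF// divr_gt0// ?q0; lra.
- apply/cvgrPdist_lt => e e0.
  pose z := Num.min (c + e) ((b + c) / 2).
  have zb : c < z < b.
    by rewrite /z lt_min gt_min; apply/andP; split; [|apply/orP; right]; lra.
  have ze : z <= c + e by rewrite /z ge_min lexx.
  near=> x; have x0 : 0 < x by near: x; exact: nbhs_right_gt.
  have xT : x < T z by near: x; apply: nbhs_right_lt; exact: T0.
  have [/andP[? ?] Ty] := yP _ x0.
  have yz : y x < z by apply: Tltr; rewrite ?Ty//; lra.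
  by rewrite distrC ger0_norm; lra.
- apply/cvgrPdist_lt => e e0.
  pose z := Num.max (b - e) ((b + c) / 2).
  have zb : c < z < b.
    by rewrite /z lt_max gt_max; apply/andP; split; [apply/orP; right|]; lra.
  have ze : b - e <= z by rewrite /z le_max lexx.
  near=> x; have xT : T z < x by near: x; apply: nbhs_pinfty_gt; exact: num_real.
  have x0 : 0 < x by apply: lt_trans xT; exact: T0.
  have [/andP[? ?] Ty] := yP _ x0.
  have yz : z < y x by apply: Tltr; rewrite ?Ty//; lra.
  by rewrite ger0_norm; lra.
Unshelve. all: by end_near.
Qed.

(** * Integration across a singular point *)

(** [f] may be unbounded at both ends. On a compact subinterval its integral is an increment of the
    monotone function [F], hence at most [F b - F a]; monotone convergence carries this bound to the
    whole interval. *)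
Lemma integrable_nonneg_derive (R : realType) (F f : R -> R) (a b : R) :
  a < b -> continuous F ->
  (forall x, a < x < b ->
     [/\ is_derive x 1 F (f x), {for x, continuous f} & 0 <= f x]) ->
  lebesgue_measure.-integrable `]a, b[ (EFin \o f).
Proof.
move=> ab cF fP.
have mf : measurable_fun `]a, b[ f.
  apply: open_continuous_measurable_fun; first exact: interval_open.
  by move=> x; rewrite inE/= in_itv/= => /fP[].
have F_le x y : a <= x -> x <= y -> y <= b -> F x <= F y.
  move=> ax; rewrite le_eqVlt => /predU1P[->//|xy] yb.
  have [|||z] := @MVT R F f x y.
  - exact: xy.
  - move=> z; rewrite in_itv/= => /andP[? ?].
    by have [|dF _ _] := fP z; [lra|exact: dF].
  - exact: continuous_subspaceT.
  rewrite in_itv/= => /andP[? ?] E.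
  have [|_ _ f0] := fP z; first lra.
  by rewrite -subr_ge0 E mulr_ge0// subr_ge0 ltW.
(* Denominators starting at [3] give [d n < (b - a) / 2], so that [S n] is nondegenerate from
   [n = 0] on. *)
pose d n : R := (b - a) / n.+3%:R.
have d0 n : 0 < d n by rewrite divr_gt0// ?subr_gt0// ltr0n.
have d2 n : d n < (b - a) / 2.
  by rewrite ltr_pM2l ?subr_gt0// ltf_pV2 ?posrE ?ltr0n// ltr_nat.
pose S n : set R := `[a + d n, b - d n]%classic.
have Sab n x : S n x -> a < x < b.
  by rewrite /S/= in_itv/= => /andP[? ?]; have := d0 n; lra.
have SE : \bigcup_n S n = `]a, b[%classic.
  apply/seteqP; split => [x [n _] /Sab//|x].
  rewrite /= in_itv/= => /andP[ax xb].
  pose e := Num.min (x - a) (b - x).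
  have e0 : 0 < e by rewrite lt_min !subr_gt0 ax.
  have [exa ebx] : e <= x - a /\ e <= b - x.
    by split; rewrite /e ge_min lexx ?orbT.
  pose n := Num.truncn ((b - a) / e).
  exists n => //; have : d n < e.
    rewrite /d ltr_pdivrMr ?ltr0n// mulrC -ltr_pdivrMr//.
    by rewrite (lt_trans (truncnS_gt _))// ltr_nat.
  by rewrite /S/= in_itv/=; lra.
have mS n : measurable (S n) by exact: measurable_itv.
have intS n : (\int[lebesgue_measure]_(x in S n) (f x)%:E
    = (F (b - d n))%:E - (F (a + d n))%:E)%E.
  apply: continuous_FTC2.
  - by have := d2 n; lra.
  - apply: continuous_in_subspaceT => x; rewrite inE => /Sab.
    by move/fP => [].
  - split.
    + by move=> x /subset_itv_oo_cc /Sab /fP[[]].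
    + by apply: cvg_at_right_filter; exact: cF.
    + by apply: cvg_at_left_filter; exact: cF.
  - by move=> x /subset_itv_oo_cc /Sab /fP[[? <-] _ _]; rewrite derive1E.
apply/integrableP; split; first exact/measurable_EFinP.
have -> : (\int[lebesgue_measure]_(x in `]a, b[) `|(EFin \o f) x|
    = \int[lebesgue_measure]_(x in \bigcup_n S n) (f x)%:E)%E.
  rewrite SE; apply: eq_integral => x; rewrite inE/= in_itv/= => /fP[_ _ f0].
  by rewrite ger0_norm.
have cS : (\int[lebesgue_measure]_(x in S n) (f x)%:E @[n --> \oo]
    --> \int[lebesgue_measure]_(x in \bigcup_n S n) (f x)%:E)%E.
  apply: ge0_nondecreasing_set_cvg_integral.
  - move=> m n mn; rewrite subsetEset => x.
    have dmn : d n <= d m.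
      by rewrite ler_pM2l ?subr_gt0// lef_pV2 ?posrE ?ltr0n// ler_nat !ltnS.
    by rewrite /S/= !in_itv/= => /andP[? ?]; lra.
  - exact: mS.
  - move=> n; apply/measurable_EFinP; apply: measurable_funS mf => //.
    by move=> x /Sab.
  - by move=> n x /Sab /fP[_ _ f0]; rewrite lee_fin.
apply: (@le_lt_trans _ _ (F b - F a)%:E); last exact: ltry.
apply: cvge_le cS; near=> n; rewrite intS -EFinB lee_fin.
have ? := d0 n; have ? := d2 n.
have : F (b - d n) <= F b by apply: F_le; lra.
have : F a <= F (a + d n) by apply: F_le; lra.
lra.
Unshelve. all: by end_near.
Qed.

Lemma singular_FTC2 (R : realType) (F f : R -> R) (a b c : R) :
  a < c < b -> continuous F ->
  (forall x, x != c -> is_derive x 1 F (f x) /\ {for x, continuous f}) ->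
  lebesgue_measure.-integrable `[a, b] (EFin \o f) ->
  \int[lebesgue_measure]_(x in `[a, b]) f x = F b - F a.
Proof.
move=> /andP[ac cb] cF fP fi.
pose G := parameterized_integral lebesgue_measure a ^~ f.
have cG := parameterized_integral_continuous (ltW (lt_trans ac cb)) fi.
(* [F - G] is constant on both sides of [c], hence across it by continuity. *)
have const p q : a <= p -> p < q -> q <= b -> (q <= c) || (c <= p) ->
    F q - G q = F p - G p.
  move=> ap pq qb pqc.
  have [|||z _] := @MVT R (fun x => F x - G x) (fun=> 0) p q.
  - exact: pq.
  - move=> x; rewrite in_itv/= => /andP[px xq].
    have xb : x < b by exact: lt_le_trans qb.
    have ax : a < x by exact: le_lt_trans px.
    have xc : x != c.
      by case/orP: pqc => ?; [rewrite lt_eqF//|rewrite gt_eqF//]; lra.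
    have [dF cf] := fP x xc.
    have [dG G'] := continuous_FTC1_closed xb fi ax cf.
    have HG : is_derive x 1 G (f x).
      by apply: (DeriveDef dG); rewrite -derive1E; exact: G'.
    rewrite -[0](subrr (f x)); exact: is_deriveB.
  - have cG' : {within `[p, q], continuous G}.
      apply: continuous_subspaceW cG.
      by apply: subset_itv; rewrite bnd_simp.
    have cF' : {within `[p, q], continuous F} by exact: continuous_subspaceT.
    by move=> x; apply: cvgB; [exact: cF'|exact: cG'].
  by rewrite mul0r => /eqP; rewrite subr_eq0 => /eqP.
have Eb : F b - G b = F c - G c by apply: const; rewrite ?lexx ?orbT// ltW.
have Ec : F c - G c = F a - G a by apply: const; rewrite ?lexx ?orbT// ltW.
have Ga : G a = 0 by rewrite /G/parameterized_integral set_itv1 Rintegral_set1.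
rewrite -[LHS]/(G b); move: Eb Ec; rewrite Ga; lra.
Qed.

Lemma measurable_continuous_off_point (R : realType) (f : R -> R) (c : R) :
  (forall x, x != c -> {for x, continuous f}) -> measurable_fun setT f.
Proof.
move=> cf; rewrite -(setvU [set c]).
have mc : measurable ([set c] : set R) by exact: measurable_set1.
apply/measurable_funU => //; first exact: measurableC.
split; last exact: measurable_fun_set1.
apply: open_continuous_measurable_fun.
  by rewrite openC; exact/accessible_closed_set1/hausdorff_accessible/Rhausdorff.
by move=> x; rewrite inE/= => /eqP; exact: cf.
Qed.

Lemma integrable_nonneg_derive_off_point (R : realType) (F f : R -> R) (a b c : R) :
  a < c < b -> continuous F ->
  (forall x, x != c ->
     [/\ is_derive x 1 F (f x), {for x, continuous f} & 0 <= f x]) ->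
  lebesgue_measure.-integrable `[a, b] (EFin \o f).
Proof.
move=> /andP[ac cb] cF fP.
have mf : measurable_fun setT f.
  by apply: (@measurable_continuous_off_point _ _ c) => x /fP[].
have i1 : lebesgue_measure.-integrable `]a, c[ (EFin \o f).
  by apply: integrable_nonneg_derive cF _ => // x /andP[_ xc]; apply: fP; rewrite lt_eqF.
have i2 : lebesgue_measure.-integrable `]c, b[ (EFin \o f).
  by apply: integrable_nonneg_derive cF _ => // x /andP[xc _]; apply: fP; rewrite gt_eqF.
(* Removing these three points, a null set, leaves the two open intervals already treated. *)
pose N : set R := [set a; b; c].
have cN : countable N.
  by apply: finite_set_countable; rewrite /N !finite_setU; do !split; exact: finite_set1.
have mN : measurable N by exact: countable_measurable.
have mE D : measurable_fun D (EFin \o f).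
  by apply/measurable_EFinP; exact: measurable_funTS.
have N0 : lebesgue_measure N = 0%E by exact: countable_lebesgue_measure0.
have mab : measurable (`[a, b]%classic : set (measurableTypeR R)).
  exact: measurable_itv.
apply/(@negligible_integrable _ _ R lebesgue_measure _ _ _ mN mab (mE _) N0).
have -> : `[a, b]%classic `\` N = `]a, c[%classic `|` `]c, b[%classic.
  apply/seteqP; split => x /=; rewrite !in_itv/=.
    move=> [/andP[ax xb] xN].
    have ax' : a < x.
      by rewrite lt_neqAle ax andbT; apply/eqP => E; apply: xN; left; left.
    have xb' : x < b.
      by rewrite lt_neqAle xb andbT; apply/eqP => E; apply: xN; left; right.
    rewrite ax' xb' andbT; case: (ltgtP x c) => E; [by left|by right|].
    by case: xN; right.
  by case=> /andP[h1 h2]; (split; first lra); move=> [[|]|] /= xE;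
    rewrite xE in h1 h2; lra.
move/integrableP : i1 => [_ i1]; move/integrableP : i2 => [_ i2].
apply/integrableP; split; first exact: mE.
rewrite ge0_integral_setU//; first by rewrite lte_add_pinfty.
  by apply: measurableT_comp => //; exact: mE.
apply/disj_setPS => x [] /=; rewrite !in_itv/= => /andP[? ?] /andP[? ?]; lra.
Qed.

(** * Test functions and weak derivatives *)

(** Around a point outside the closed support, [phi] is [0] on a neighbourhood, so its derivative
    vanishes there; the new support is a closed subset of a compact set. *)
Lemma test_function_deriv (R : realType) (phi : R -> R) :
  test_function phi -> test_function phi^`()%classic.
Proof.
move=> [dphi cphi]; split => [n x|]; first by rewrite -derive1Sn; exact: dphi.
apply: subclosed_compact cphi _; first exact: closed_closure.
rewrite closureE; apply: smallest_sub; first exact: closed_closure.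
move=> x /= phi'x; apply: contrapT => xS; move/eqP: phi'x; apply.
rewrite derive1E (@near_eq_derive _ _ _ _ (cst 0)) ?derive_cst//.
have : nbhs x (~` closure [set x | phi x != 0]).
  by apply: open_nbhs_nbhs; split => //; rewrite openC; exact: closed_closure.
apply: filterS => y yS; apply/eqP/negP => /negP phiy.
by apply: yS; exact: subset_closure.
Qed.

Lemma test_function_continuous (R : realType) (phi : R -> R) :
  test_function phi -> continuous phi.
Proof.
by move=> [/(_ 0%N) dphi _] x; exact/differentiable_continuous/derivable1_diffP.
Qed.

Lemma test_function_support (R : realType) (phi : R -> R) :
  test_function phi -> exists M : R, forall x, M < `|x| -> phi x = 0.
Proof.
move=> [_ /compact_bounded[M [_ HM]]]; exists (M + 1) => x Mx.
apply/eqP/negP => /negP phix.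
have M1 : M < M + 1 by rewrite ltrDl.
have : `|x| <= M + 1 by apply: (HM _ M1); exact: subset_closure.
by rewrite leNgt Mx.
Qed.

(** A test function is bounded on segments and vanishes outside some [[- M, M]]. Integrability of
    [g] is asked only for large [M], so that these intervals can be taken to have a singular point
    in their interior. *)
Lemma integrable_mul_test_function (R : realType) (g phi : R -> R) :
  measurable_fun setT g ->
  (exists A : R, forall M, A < M -> lebesgue_measure.-integrable `[- M, M] (EFin \o g)) ->
  test_function phi ->
  lebesgue_measure.-integrable setT (EFin \o (fun x => g x * phi x)).
Proof.
move=> mg [A ig] tphi; have [M0 HM0] := test_function_support tphi.
pose M := Num.max (Num.max A M0) 0 + 1.
have [AM M0M] : A < M /\ M0 < M /\ 0 < M.
  by rewrite /M !ltr_pwDr// !le_max !lexx ?orbT.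
have cphi := test_function_continuous tphi.
have : lebesgue_measure.-integrable `[- M, M] (EFin \o (fun x => g x * phi x)).
  pose gphi := (fun x => (phi x)%:E * (g x)%:E)%E.
  apply: (@eq_integrable _ _ _ lebesgue_measure _ (measurable_itv _) gphi).
    by move=> x _; rewrite /gphi/= mulrC EFinM.
  apply: integrableMr => //.
  - by apply: measurable_funTS; exact: continuous_measurable_fun.
  - have /compact_bounded[N [Nr HN]] : compact (phi @` `[- M, M]).
      apply: continuous_compact; last exact: segment_compact.
      exact: continuous_subspaceT.
    by exists N; split => // N' NN' x xM; apply: HN => //; exists x.
  - exact: ig.
have mM : measurable (`[- M, M]%classic : set (measurableTypeR R)).
  exact: measurable_itv.
move=> /(proj1 (@integrable_mkcond _ _ R lebesgue_measure _ _ mM)) iM.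
apply: (eq_integrable _ _ _ _ iM) => // x _ /=.
rewrite patchE; case: ifPn => //; rewrite notin_setE/= in_itv/= => /negP.
rewrite -ler_norml -ltNge => xM; rewrite HM0 ?mulr0//.
by case: M0M => ? _; lra.
Qed.

(** Integration by parts: [f * phi] is continuous across [c], so no jump contributes there, and its
    boundary values are [0] outside the support of [phi]. *)
Lemma distr_deriv_off_point (R : realType) (f df : R -> R) (c : R) :
  continuous f ->
  (forall x, x != c -> is_derive x 1 f (df x) /\ {for x, continuous df}) ->
  (forall M : R, `|c| < M -> lebesgue_measure.-integrable `[- M, M] (EFin \o df)) ->
  distr_eq (distr_deriv (distr f)) (distr df).
Proof.
move=> cf fP idf phi tphi.
have tphi' := test_function_deriv tphi.
have cphi := test_function_continuous tphi.
have cphi' := test_function_continuous tphi'.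
have i1 : lebesgue_measure.-integrable setT (EFin \o (fun x => df x * phi x)).
  apply: integrable_mul_test_function => //; last by exists `|c|.
  by apply: (@measurable_continuous_off_point _ _ c) => x /fP[].
have i2 : lebesgue_measure.-integrable setT (EFin \o (fun x => f x * phi^`()%classic x)).
  apply: integrable_mul_test_function => //; first exact: continuous_measurable_fun.
  exists 0 => M _; apply: continuous_compact_integrable; first exact: segment_compact.
  exact: continuous_subspaceT.
suff : \int[lebesgue_measure]_x (f x * phi^`()%classic x + df x * phi x) = 0.
  by rewrite RintegralD// /distr_deriv /distr => /eqP; rewrite addrC addr_eq0 => /eqP ->.
have [M0 HM0] := test_function_support tphi.
have [M1 HM1] := test_function_support tphi'.
pose M := Num.max (Num.max M0 M1) `|c| + 1.
have [M0M [M1M cM]] : M0 < M /\ M1 < M /\ `|c| < M.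
  by rewrite /M !ltr_pwDr// !le_max !lexx ?orbT.
have Mpos : 0 < M by exact: le_lt_trans cM.
pose dG x := f x * phi^`()%classic x + df x * phi x.
have dGi : lebesgue_measure.-integrable setT (EFin \o dG).
  exact: (integrableD measurableT i2 i1).
have -> : \int[lebesgue_measure]_x (f x * phi^`()%classic x + df x * phi x)
    = \int[lebesgue_measure]_(x in `[- M, M]) dG x.
  rewrite [RHS]Rintegral_mkcond; apply: eq_Rintegral => x _.
  rewrite patchE; case: ifPn => //; rewrite notin_setE/= in_itv/= => /negP.
  rewrite -ler_norml -ltNge => xM.
  by rewrite HM0 ?HM1 ?mulr0 ?addr0//; lra.
rewrite (@singular_FTC2 _ (fun x => f x * phi x) dG (- M) M c).
- by rewrite !HM0 ?mulr0 ?subrr ?normrN ?gtr0_norm.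
- by rewrite -ltr_norml.
- by move=> x; apply: cvgM; [exact: cf|exact: cphi].
- move=> x /fP[dfx cdf]; split; last first.
    by apply: cvgD; apply: cvgM => //; [exact: cf|exact: cphi'|exact: cphi].
  have dphi : is_derive x 1 phi (phi^`()%classic x).
    by apply: DeriveDef; [exact: (tphi.1 0%N)|rewrite derive1E].
  rewrite /dG [df x * _]mulrC; exact: is_deriveM.
- by apply: integrableS dGi.
Qed.

(** * The first integral *)

(* [h'^2] along the half-orbit asymptotic to [b]; it is [0] by convention at the
   singularity [h = c]. *)
Definition slope_sq (R : realType) (delta b c h : R) : R :=
  (h - b) ^+ 2 * h ^+ 2 * (h - c ^+ 3 / b ^+ 2) / (delta * (h ^+ 3 - c ^+ 3)).

(** Differentiating [h'^2 = W(h)] and dividing by [2 h'] gives [h'' = W'(h) / 2]; this is [W'], and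
    its half is what enters below. *)
Definition slope_sq' (R : realType) (delta b c h : R) : R :=
  ((2 * (h - b) * h ^+ 2 + 2 * (h - b) ^+ 2 * h) * (h - c ^+ 3 / b ^+ 2)
     + (h - b) ^+ 2 * h ^+ 2) / (delta * (h ^+ 3 - c ^+ 3))
  - (h - b) ^+ 2 * h ^+ 2 * (h - c ^+ 3 / b ^+ 2) * (3 * h ^+ 2)
    / (delta * (h ^+ 3 - c ^+ 3) ^+ 2).

Lemma is_derive_slope_sq (R : realType) (delta b c h : R) :
  delta != 0 -> b != 0 -> h ^+ 3 - c ^+ 3 != 0 ->
  is_derive h 1 (slope_sq delta b c) (slope_sq' delta b c h).
Proof.
move=> d0 b0 hc0; have D0 : delta * (h ^+ 3 - c ^+ 3) != 0 by rewrite mulf_neq0.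
rewrite /slope_sq; apply: is_derive_eq.
rewrite /slope_sq' /GRing.scale/= -!exprVn; field.
by rewrite d0 b0 hc0.
Qed.

Lemma subr_cube_neq0 (R : realType) (h c : R) :
  0 < c -> h != c -> h ^+ 3 - c ^+ 3 != 0.
Proof.
move=> c0 hc; rewrite (_ : _ - _ = (h - c) * (h ^+ 2 + h * c + c ^+ 2)); last ring.
rewrite mulf_neq0 ?subr_eq0// gt_eqF//; have := sqr_ge0 (h + c / 2); nra.
Qed.

(** This is the profile equation for [h = 1 + eta], with [slope_sq' / 2] for [h''] and [slope_sq]
    for [h'^2]. The factor in front of [h ^+ 3] is [sigma], and [3 * h - 2] is [1 + 3 eta]. *)
Lemma slope_sq_profile (R : realType) (delta b c h : R) :
  0 < delta -> 0 < b -> 0 < c -> 0 < h -> h != c ->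
  delta * (slope_sq' delta b c h / 2) = h - 1 + c ^+ 3 / (2 * (c ^+ 3 - h ^+ 3))
    * ((2 * b + c ^+ 3 / b ^+ 2 - 2) / c ^+ 3 * h ^+ 3 - (3 * h - 2)
       + 3 * delta * (slope_sq delta b c h / h)).
Proof.
move=> d0 b0 c0 h0 hc; have hc3 := subr_cube_neq0 c0 hc.
rewrite /slope_sq /slope_sq'; field.
rewrite hc3 -opprB oppr_eq0 hc3 !gt_eqF//.
Qed.

(** With [P = h - 1 + c^3 / (2 h^2)], the left side is [delta P''] by the chain rule and the right
    side is [P - P_b + 3/2 delta u'^2], since [u'^2 = c^3 h'^2 / h^4]. *)
Lemma slope_sq_momentum (R : realType) (delta b c h : R) :
  0 < delta -> 0 < b -> 0 < c -> 0 < h -> h != c ->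
  delta * (3 * c ^+ 3 / h ^+ 4 * slope_sq delta b c h
           + (1 - c ^+ 3 / h ^+ 3) * (slope_sq' delta b c h / 2))
  = h - 1 + c ^+ 3 / (2 * h ^+ 2) - (b - 1 + c ^+ 3 / (2 * b ^+ 2))
    + 3 / 2 * delta * (c ^+ 3 * slope_sq delta b c h / h ^+ 4).
Proof.
move=> d0 b0 c0 h0 hc; have hc3 := subr_cube_neq0 c0 hc.
rewrite /slope_sq /slope_sq'; field.
by rewrite hc3 !gt_eqF.
Qed.

(* [(1 - c^3 / h^3) h'] is the derivative of [h + c^3 / (2 h^2)]: unlike [h'],
   it vanishes at the singularity [h = c]. *)
Lemma slope_sq_flux (R : realType) (delta b c h : R) :
  0 < delta -> 0 < b -> 0 < c -> 0 < h ->
  (1 - c ^+ 3 / h ^+ 3) ^+ 2 * slope_sq delta b c h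
  = (h - b) ^+ 2 * (h - c ^+ 3 / b ^+ 2) * (h ^+ 3 - c ^+ 3) / (delta * h ^+ 4).
Proof.
move=> d0 b0 c0 h0; have [->|hc] := eqVneq h c.
  by rewrite divff ?subrr ?expr0n ?mul0r ?mulr0 ?mul0r// expf_neq0// gt_eqF.
have hc3 := subr_cube_neq0 c0 hc.
rewrite /slope_sq; field.
by rewrite hc3 !gt_eqF.
Qed.

(* [|h - b| / arrival_weight] is the square root of [slope_sq]. Since [Num.sqrt]
   is [0] on negative numbers, the weight extends continuously past [h = c]. *)
Definition arrival_weight (R : realType) (delta b c h : R) : R :=
  Num.sqrt (delta * (h ^+ 3 - c ^+ 3) / (h - c ^+ 3 / b ^+ 2)) / h.

Lemma arrival_weight_gt0 (R : realType) (delta b c h : R) : 0 < h ->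
  0 < delta * (h ^+ 3 - c ^+ 3) / (h - c ^+ 3 / b ^+ 2) ->
  0 < arrival_weight delta b c h.
Proof. by move=> h0 X0; rewrite divr_gt0// sqrtr_gt0. Qed.

Lemma arrival_weight_continuous (R : realType) (delta b c h : R) : h != 0 ->
  h != c ^+ 3 / b ^+ 2 -> {for h, continuous (arrival_weight delta b c)}.
Proof.
move=> h0 ha; apply: cvgM; last by apply: cvgV => //; exact: cvg_id.
apply: continuous_comp; last exact: sqrt_continuous.
apply: cvgM.
  by apply: cvgM; [exact: cvg_cst|apply: cvgB; [exact: exprn_continuous|exact: cvg_cst]].
by apply: cvgV; [rewrite subr_eq0|apply: cvgB; [exact: cvg_id|exact: cvg_cst]].
Qed.

Lemma slope_sqE (R : realType) (delta b c h : R) : 0 < h ->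
  0 < delta * (h ^+ 3 - c ^+ 3) / (h - c ^+ 3 / b ^+ 2) ->
  slope_sq delta b c h = ((h - b) / arrival_weight delta b c h) ^+ 2.
Proof.
move=> h0 X0; rewrite /slope_sq /arrival_weight.
set X := (X in Num.sqrt X) in X0 *.
rewrite [RHS](_ : _ = (h - b) ^+ 2 * h ^+ 2 / Num.sqrt X ^+ 2); last first.
  by field; rewrite !gt_eqF ?sqrtr_gt0.
by rewrite sqr_sqrtr ?(ltW X0)// /X invf_div !mulrA.
Qed.

(** * Existence of the two half-profiles *)

(** Seen backwards from the singularity, [h] increases from [c] to [b], so [h x = y (- x)] with [y]
    solving the autonomous equation of weight [arrival_weight]. The zero [a] of the denominator lies
    below [c], which leaves room for continuity of the weight across [c]. *)
Lemma left_profile_exists (R : realType) (delta b c : R) : 0 < delta -> 0 < c < b ->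
  exists h : R -> R,
    [/\ forall x : R, x < 0 -> c < h x < b,
        forall x : R, x < 0 -> 0 < slope_sq delta b c (h x),
        forall x : R, x < 0 ->
          is_derive x 1 h (- Num.sqrt (slope_sq delta b c (h x))),
        h x @[x --> 0^'-] --> c & h x @[x --> -oo] --> b].
Proof.
move=> d0 /andP[c0 cb]; pose a := c ^+ 3 / b ^+ 2.
have b0 : 0 < b by exact: lt_trans cb.
have a0 : 0 < a by rewrite divr_gt0// exprn_gt0.
have ac : a < c by rewrite /a ltr_pdivrMr ?exprn_gt0// exprS ltr_pM2l// ltrXn2r//; lra.
have X0 h : c < h -> 0 < delta * (h ^+ 3 - c ^+ 3) / (h - a).
  move=> ch; rewrite divr_gt0 ?subr_gt0 ?mulr_gt0 ?subr_gt0//; last lra.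
  by rewrite ltrXn2r//; lra.
have [|h|h|y [yr dy y0 yoo]] :=
  @autonomous_ode R (arrival_weight delta b c) a b c.
- by rewrite ac.
- move=> /andP[ah hb]; apply: arrival_weight_continuous; last by rewrite gt_eqF.
  by rewrite gt_eqF//; lra.
- by move=> /andP[ch _]; apply: arrival_weight_gt0; [lra|exact: X0].
have slopeE x : 0 < x -> 0 < slope_sq delta b c (y x) /\
    Num.sqrt (slope_sq delta b c (y x)) = (b - y x) / arrival_weight delta b c (y x).
  move=> x0; have /andP[cy yb] := yr x x0.
  have w0 : 0 < arrival_weight delta b c (y x).
    by apply: arrival_weight_gt0; [lra|exact: X0].
  have v0 : 0 < (b - y x) / arrival_weight delta b c (y x) by rewrite divr_gt0// subr_gt0.
  have -> : slope_sq delta b c (y x) =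
      ((b - y x) / arrival_weight delta b c (y x)) ^+ 2.
    by rewrite slope_sqE; [rewrite -opprB mulNr sqrrN|lra|exact: X0].
  by rewrite exprn_gt0// sqrtr_sqr gtr0_norm.
exists (y \o -%R); split => [x x0|x x0|x x0||].
- by apply: yr; rewrite oppr_gt0.
- by have [] := slopeE (- x); rewrite ?oppr_gt0.
- have x0' : 0 < - x by rewrite oppr_gt0.
  have [_ ->] := slopeE _ x0'; rewrite -mulrN1.
  by apply: is_derive1_comp; exact: dy.
- by apply/cvg_at_leftNP; rewrite oppr0; apply: cvg_trans y0; apply: near_eq_cvg;
    near=> x; rewrite /= opprK.
- apply/cvgNy_compNP; apply: cvg_trans yoo; apply: near_eq_cvg.
  by near=> x; rewrite /= opprK.
Unshelve. all: by end_near.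
Qed.

(** The reflection [y = - h] turns the decrease from [c] to [b] into an increase from [- c] to
    [- b]. The order is now [b < c < a], so [h ^+ 3 - c ^+ 3] and [h - a] are both negative along
    the orbit. *)
Lemma right_profile_exists (R : realType) (delta b c : R) : 0 < delta -> 0 < b < c ->
  exists h : R -> R,
    [/\ forall x : R, 0 < x -> b < h x < c,
        forall x : R, 0 < x -> 0 < slope_sq delta b c (h x),
        forall x : R, 0 < x ->
          is_derive x 1 h (- Num.sqrt (slope_sq delta b c (h x))),
        h x @[x --> 0^'+] --> c & h x @[x --> +oo] --> b].
Proof.
move=> d0 /andP[b0 bc]; pose a := c ^+ 3 / b ^+ 2.
have c0 : 0 < c by exact: lt_trans bc.
have ca : c < a by rewrite /a ltr_pdivlMr ?exprn_gt0// [_ ^+ 3]exprS ltr_pM2l// ltrXn2r//; lra.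
have X0 h : b <= h < c -> 0 < delta * (h ^+ 3 - c ^+ 3) / (h - a).
  move=> /andP[bh hc]; rewrite -mulrA mulr_gt0// -mulrNN -invrN !opprB.
  rewrite divr_gt0 ?subr_gt0//; last lra.
  by rewrite ltrXn2r//; lra.
have [|h|h|y [yr dy y0 yoo]] :=
  @autonomous_ode R (arrival_weight delta b c \o -%R) (- a) (- b) (- c).
- by rewrite !ltrN2 ca.
- move=> /andP[ah hb]; apply: continuous_comp; first exact: opp_continuous.
  by apply: arrival_weight_continuous; [rewrite gt_eqF//|rewrite -/a lt_eqF//]; lra.
- by move=> /andP[ch hb]; apply: arrival_weight_gt0; [|apply: X0]; lra.
have slopeE x : 0 < x -> 0 < slope_sq delta b c (- y x) /\
    Num.sqrt (slope_sq delta b c (- y x)) =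
    (- b - y x) / arrival_weight delta b c (- y x).
  move=> x0; have /andP[cy yb] := yr x x0.
  have Xy : 0 < delta * ((- y x) ^+ 3 - c ^+ 3) / (- y x - a) by apply: X0; lra.
  have w0 : 0 < arrival_weight delta b c (- y x).
    by apply: arrival_weight_gt0 => //; lra.
  have v0 : 0 < (- b - y x) / arrival_weight delta b c (- y x).
    by rewrite divr_gt0//; lra.
  rewrite slope_sqE//; last lra.
  by rewrite [- y x - b]addrC exprn_gt0// sqrtr_sqr gtr0_norm.
exists (-%R \o y); split => [x x0|x x0|x x0||].
- by have := yr x x0; rewrite /=; lra.
- by have [] := slopeE x.
- by have [_ /= ->] := slopeE _ x0; apply: is_deriveN; exact: dy.
- by rewrite -[c]opprK; apply: cvgN; exact: y0.
- by rewrite -[b]opprK; apply: cvgN; exact: yoo.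
Qed.

(** The factor [Num.sqrt (W (h x))] in [h'] cancels the root in the denominator of the derivative of
    the square root. *)
Lemma is_derive_slope (R : realType) (W h : R -> R) (w x : R) :
  is_derive x 1 h (- Num.sqrt (W (h x))) -> 0 < W (h x) ->
  is_derive (h x) 1 W w ->
  is_derive x 1 (fun x => - Num.sqrt (W (h x))) (w / 2).
Proof.
move=> dh W0 dW.
have dWh := is_derive1_comp dW dh.
have dS : is_derive ((W \o h) x) 1 Num.sqrt (2 * Num.sqrt (W (h x)))^-1.
  exact: is_derive1_sqrt.
apply: (is_derive_eq (is_deriveN (is_derive1_comp dS dWh))).
by field; rewrite gt_eqF ?sqrtr_gt0.
Qed.

Lemma slope_sq'_continuous (R : realType) (delta b c h : R) :
  delta != 0 -> b != 0 -> h ^+ 3 - c ^+ 3 != 0 ->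
  {for h, continuous (slope_sq' delta b c)}.
Proof.
move=> d0 b0 hc0; have D1 : delta * (h ^+ 3 - c ^+ 3) != 0 by rewrite mulf_neq0.
have D2 : delta * (h ^+ 3 - c ^+ 3) ^+ 2 != 0 by rewrite mulf_neq0// expf_neq0.
rewrite /slope_sq'; eapply is_derive1_continuous.
by typeclasses eauto.
Qed.

(** [D] stands for either half-line and [b] for the depth at its far end. Openness of [D] makes the
    formula for [eta'] a local equality, which can be differentiated again. *)
Lemma profile_equation_of_slope (R : realType) (delta s hp up b c : R)
    (eta : R -> R) (D : set R) : open D -> 0 < delta -> 0 < b -> 0 < c ->
  c ^+ 3 = mass_flux s hp up ^+ 2 ->
  sigma_coef s hp up = (2 * b + c ^+ 3 / b ^+ 2 - 2) / c ^+ 3 ->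
  (forall x : R, D x ->
     [/\ 0 < 1 + eta x, 1 + eta x != c, 0 < slope_sq delta b c (1 + eta x)
       & is_derive x 1 eta (- Num.sqrt (slope_sq delta b c (1 + eta x)))]) ->
  [/\ C2_on D eta, forall x : R, D x -> profile_equation_at delta s hp up eta x
    & forall x : R, D x ->
        eta^`()%classic x = - Num.sqrt (slope_sq delta b c (1 + eta x))].
Proof.
move=> oD d0 b0 c0 cC sigE etaP.
pose eta1 (x : R) : R := - Num.sqrt (slope_sq delta b c (1 + eta x)).
pose eta2 (x : R) : R := slope_sq' delta b c (1 + eta x) / 2.
have nearD x : D x -> \forall y \near x, D y.
  by move=> Dx; exact: open_nbhs_nbhs.
have E1 x : D x -> eta^`()%classic x = eta1 x.
  by move=> /etaP[_ _ _ [_ dE]]; rewrite derive1E; exact: dE.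
have d1 x : D x -> is_derive x 1 eta1 (eta2 x).
  move=> /etaP[h0 hc W0 de].
  have dW : is_derive (1 + eta x) 1 (slope_sq delta b c)
      (slope_sq' delta b c (1 + eta x)).
    by apply: is_derive_slope_sq; rewrite ?subr_cube_neq0// gt_eqF.
  have dh : is_derive x 1 (fun x => 1 + eta x)
      (- Num.sqrt (slope_sq delta b c (1 + eta x))).
    by have := is_deriveD (is_derive_cst (1 : R) x 1) de; rewrite add0r.
  exact: (is_derive_slope dh W0 dW).
have d1' x : D x -> is_derive x 1 eta^`()%classic (eta2 x).
  move=> Dx; apply: near_eq_is_derive (d1 x Dx).
  by apply: filterS (nearD x Dx) => y /E1.
have E2 x : D x -> eta^`(2)%classic x = eta2 x.
  by move=> /d1'[_ dE]; rewrite derive1nS derive1E; exact: dE.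
split => // [x Dx|x Dx].
- have [h0 hc W0 de] := etaP x Dx; split.
  + by case: de.
  + by case: (d1' x Dx).
  + have ce2 : {for x, continuous eta2}.
      apply: cvgM; last exact: cvg_cst.
      apply: (@cvg_comp _ _ _ (fun x => 1 + eta x) _ _ (nbhs (1 + eta x))).
        by apply: cvgD; [exact: cvg_cst|exact: is_derive1_continuous de].
      by apply: slope_sq'_continuous; rewrite ?subr_cube_neq0// gt_eqF.
    have : eta2 y @[y --> x] --> eta^`(2)%classic x by rewrite (E2 x Dx); exact: ce2.
    apply: cvg_trans.
    by apply: near_eq_cvg; apply: filterS (nearD x Dx) => y /E2.
- have [h0 hc W0 de] := etaP x Dx; rewrite /profile_equation_at E2// E1//.
  rewrite /eta2 slope_sq_profile// -cC sigE sqrrN sqr_sqrtr ?(ltW W0)//.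
  rewrite (_ : 1 + eta x - 1 = eta x); last ring.
  by rewrite (_ : 3 * (1 + eta x) - 2 = 1 + 3 * eta x); last ring.
Qed.

(** * The equations in the sense of distributions *)

Lemma L2_loc_integrable (R : realType) (f : R -> R) : measurable_fun setT f ->
  (forall M : R, 0 < M ->
     lebesgue_measure.-integrable `[- M, M] (EFin \o (fun x => f x ^+ 2))) ->
  L2_loc f.
Proof.
move=> mf fi; have mf2 : measurable_fun setT (fun x => f x ^+ 2).
  exact: measurable_funX.
split => //; split => //; first exact: openT.
move=> K _ cK; have [M0 [_ HM]] := compact_bounded cK.
pose M := Num.max M0 0 + 1.
have [M0M M0'] : M0 < M /\ 0 < M by rewrite /M !ltr_pwDr// le_max lexx ?orbT.
have : lebesgue_measure.-integrable K (EFin \o (fun x => f x ^+ 2)).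
  apply: integrableS (fi _ M0') => //; first exact: compact_measurable.
  by move=> x Kx; rewrite /= in_itv/= -ler_norml; exact: HM.
by case/integrableP.
Qed.

(** [|f| <= 1 + f ^+ 2], and constants are integrable on a bounded interval. *)
Lemma integrable_of_sqr (R : realType) (f : R -> R) (a b : R) :
  measurable_fun setT f ->
  lebesgue_measure.-integrable `[a, b] (EFin \o (fun x => f x ^+ 2)) ->
  lebesgue_measure.-integrable `[a, b] (EFin \o f).
Proof.
move=> mf f2i.
have i1 : lebesgue_measure.-integrable `[a, b] (EFin \o (fun=> 1 : R)).
  apply: continuous_compact_integrable; first exact: segment_compact.
  by apply: continuous_subspaceT => x; exact: cvg_cst.
apply: (@le_integrable _ _ R lebesgue_measure _ (measurable_itv _)
  (EFin \o f) (EFin \o (fun x => 1 + f x ^+ 2))).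
- by apply/measurable_EFinP; exact: measurable_funTS.
- move=> x _; rewrite /= lee_fin [leRHS]ger0_norm ?addr_ge0 ?sqr_ge0// ler_norml.
  have := sqr_ge0 (f x - 1); have := sqr_ge0 (f x + 1); nra.
- by apply: (eq_integrable _ _ _ _ (integrableD _ i1 f2i)).
Qed.

(** [h] is the profile glued across [0], where [h1] and [h2] need not be derivatives. Continuity of
    the flux excludes a point mass in [P''], the single constant [K] on both sides is removed by the
    outer derivative, and the bound [B] lets [u'^2] control [h'^2]. *)
Lemma weak_solution_of_profile (R : realType) (delta s C c K B : R) (h h1 h2 eta u : R -> R) :
  0 < delta -> 0 < c -> c ^+ 3 = C ^+ 2 -> continuous h ->
  (forall x, 0 < h x < B) ->
  (forall x : R, x != 0 -> is_derive x 1 h (h1 x) /\ is_derive x 1 h1 (h2 x)) ->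
  (forall x : R, x != 0 ->
     delta * (3 * c ^+ 3 / h x ^+ 4 * h1 x ^+ 2 + (1 - c ^+ 3 / h x ^+ 3) * h2 x)
     = h x - 1 + c ^+ 3 / (2 * h x ^+ 2) - K
       + 3 / 2 * delta * (c ^+ 3 * h1 x ^+ 2 / h x ^+ 4)) ->
  continuous (fun x : R => (1 - c ^+ 3 / h x ^+ 3) * h1 x) ->
  (forall x, eta x = h x - 1) -> (forall x, u x = s + C / h x) ->
  exists deta du : R -> R,
        [/\ L2_loc deta /\ distr_eq (distr_deriv (distr eta)) (distr deta),
            L2_loc du /\ distr_eq (distr_deriv (distr u)) (distr du),
            distr_eq
              (distr_add (distr_scale (- s) (distr_deriv (distr eta)))
                 (distr_deriv (distr (fun x => (1 + eta x) * u x))))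
              (distr (fun=> 0)) &
            let P x := eta x + 2^-1 * (u x - s) ^+ 2 in
            distr_eq
              (distr_deriv
                 (distr_add
                    (distr_add (distr P)
                       (distr_scale (- delta)
                          (distr_deriv (distr_deriv (distr P)))))
                    (distr_scale (3 / 2 * delta)
                       (distr (fun x => du x ^+ 2)))))
              (distr (fun=> 0))].
Proof.
move=> d0 c0 cC ch hB hP mom cPd etaE uE.
pose P (x : R) : R := h x - 1 + c ^+ 3 / (2 * h x ^+ 2).
pose Pd (x : R) : R := (1 - c ^+ 3 / h x ^+ 3) * h1 x.
pose du (x : R) : R := - C * h1 x / h x ^+ 2.
(* The momentum balance solved for [P'']; unlike the chain-rule formula, it is
   linear in [du ^+ 2] at every point, including [0]. *)
pose Pdd (x : R) : R := (P x - K + 3 / 2 * delta * du x ^+ 2) / delta.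
have h0 (x : R) : 0 < h x by case/andP: (hB x).
have hn0 (x : R) : h x != 0 by rewrite gt_eqF.
have cX (f : R -> R) n (x : R) : {for x, continuous f} ->
    {for x, continuous (fun x => f x ^+ n)}.
  move=> cf; apply: (@cvg_comp _ _ _ f (fun y => y ^+ n) _ (nbhs (f x))).
    exact: cf.
  exact: exprn_continuous.
have chV n (x : R) : {for x, continuous (fun x : R => (h x ^+ n)^-1)}.
  apply: cvgV; first by rewrite expf_neq0.
  by apply: cX; exact: ch.
have PE : P = (fun x => h x - 1 + c ^+ 3 / 2 * (h x ^+ 2)^-1).
  by apply/funext => y; rewrite /P invfM mulrA.
have cP : continuous P.
  rewrite PE => x; apply: cvgD; first by apply: cvgB; [exact: ch|exact: cvg_cst].
  by apply: cvgM; [exact: cvg_cst|exact: chV].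
have cu : continuous (fun x : R => s + C / h x).
  move=> x; apply: cvgD; first exact: cvg_cst.
  by apply: cvgM; [exact: cvg_cst|exact: (chV 1%N)].
have ch1 (x : R) : x != 0 -> {for x, continuous h1}.
  by move=> /hP[_ dh1]; exact: is_derive1_continuous dh1.
have cdu (x : R) : x != 0 -> {for x, continuous du}.
  move=> x0; apply: cvgM; last exact: chV.
  by apply: cvgM; [exact: cvg_cst|exact: ch1].
have cPdd (x : R) : x != 0 -> {for x, continuous Pdd}.
  move=> x0; apply: cvgM; last exact: cvg_cst.
  apply: cvgD; first by apply: cvgB; [exact: cP|exact: cvg_cst].
  by apply: cvgM; [exact: cvg_cst|apply: cX; exact: cdu].
have dhV n (x : R) : x != 0 ->
    is_derive x 1 (fun x : R => (h x ^+ n)^-1) (- n%:R * h1 x / h x ^+ n.+1).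
  move=> /hP[dh _].
  have hnn : h x ^+ n != 0 by rewrite expf_neq0.
  have dX : is_derive x 1 (fun y => h y ^+ n) ((n%:R * h x ^+ n.-1) *: h1 x).
    have := is_deriveX n dh; rewrite exprfctE; exact.
  apply: (is_derive_eq (@is_deriveV _ (fun y => h y ^+ n) _ _ _ hnn dX)).
  rewrite /GRing.scale/=; move: dX hnn => _; case: n => [|n] hnn; first by rewrite !mul0r mulr0 oppr0 !mul0r.
  by rewrite /= !exprS; field; rewrite hn0 expf_neq0.
have dP (x : R) : x != 0 -> is_derive x 1 P (Pd x).
  move=> x0; have [dh _] := hP x x0; have d2 := dhV 2%N x x0.
  rewrite PE.
  apply: is_derive_eq; rewrite /Pd /GRing.scale/=; field.
  by rewrite hn0.
have ddu (x : R) : x != 0 -> is_derive x 1 (fun x : R => s + C / h x) (du x).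
  move=> x0; have [dh dh1] := hP x x0; have d1 := dhV 1%N x x0.
  rewrite (_ : (fun x => _) = (fun x : R => s + C * (h x ^+ 1)^-1)); last by [].
  apply: is_derive_eq; rewrite /du /GRing.scale/=; field.
  by rewrite hn0.
have du2 (x : R) : du x ^+ 2 = c ^+ 3 * h1 x ^+ 2 / h x ^+ 4.
  by rewrite /du cC; field; rewrite hn0.
have dPd (x : R) : x != 0 -> is_derive x 1 Pd (Pdd x).
  move=> x0; have [dh dh1] := hP x x0; have d3 := dhV 3%N x x0.
  have -> : Pdd x = 3 * c ^+ 3 / h x ^+ 4 * h1 x ^+ 2
      + (1 - c ^+ 3 / h x ^+ 3) * h2 x.
    apply: (mulfI (lt0r_neq0 d0)).
    by rewrite mom// /Pdd mulrC divfK ?gt_eqF// du2.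
  rewrite /Pd; apply: is_derive_eq; rewrite /GRing.scale/=; field.
  by rewrite hn0.
have P_gt (x : R) : -1 < P x.
  have : 0 < c ^+ 3 / (2 * h x ^+ 2) by rewrite divr_gt0 ?mulr_gt0 ?exprn_gt0.
  by rewrite /P; have := h0 x; lra.
have icont (f : R -> R) (M : R) : continuous f ->
    lebesgue_measure.-integrable `[- M, M] (EFin \o f).
  move=> cf; apply: continuous_compact_integrable; first exact: segment_compact.
  exact: continuous_subspaceT.
have iPdd (M : R) : 0 < M ->
    lebesgue_measure.-integrable `[- M, M] (EFin \o Pdd).
  (* [Pdd + k >= 0] because [P > -1]. *)
  move=> M0; pose k := (K + 1) / delta.
  have : lebesgue_measure.-integrable `[- M, M] (EFin \o (fun x => Pdd x + k)).
    apply: (@integrable_nonneg_derive_off_point _ (fun x => Pd x + k * x) _ _ _ 0).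
    - by rewrite oppr_lt0 M0.
    - move=> x; apply: cvgD; first exact: cPd.
      by apply: cvgM; [exact: cvg_cst|exact: cvg_id].
    - move=> x x0; have d1 := dPd x x0; split.
      + by apply: is_derive_eq; rewrite /GRing.scale/=; ring.
      + by apply: cvgD; [exact: cPdd|exact: cvg_cst].
      + rewrite /Pdd /k -mulrDl divr_ge0 ?(ltW d0)//.
        have := P_gt x; have := mulr_ge0 (ltW d0) (sqr_ge0 (du x)); lra.
  move=> i1.
  have i2 : lebesgue_measure.-integrable `[- M, M] (EFin \o (fun=> k)).
    by apply: icont => x; exact: cvg_cst.
  apply: (eq_integrable _ _ _ _ (integrableB _ i1 i2)) => // x _ /=.
  by rewrite -EFinB addrK.
have idu2 (M : R) : 0 < M ->
    lebesgue_measure.-integrable `[- M, M] (EFin \o (fun x => du x ^+ 2)).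
  (* Solving the definition of [Pdd] gives [du^2 = 2/3 Pdd + 2/(3 delta) (K - P)], an integrable
     term plus a continuous one. *)
  move=> M0; have i1 := integrableZl _ (2 / 3) (iPdd _ M0).
  have i2 : lebesgue_measure.-integrable `[- M, M]
      (EFin \o (fun x => 2 / (3 * delta) * (K - P x))).
    apply: icont => x; apply: cvgM; first exact: cvg_cst.
    by apply: cvgB; [exact: cvg_cst|exact: cP].
  apply: (eq_integrable _ _ _ _ (integrableD _ (i1 _) i2)) => // x _ /=.
  by rewrite -EFinM -EFinD /Pdd; congr EFin; field; rewrite gt_eqF.
have mdu : measurable_fun setT du.
  exact: (@measurable_continuous_off_point _ _ 0).
have mh1 : measurable_fun setT h1.
  exact: (@measurable_continuous_off_point _ _ 0).
have ih1 (M : R) : 0 < M ->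
    lebesgue_measure.-integrable `[- M, M] (EFin \o (fun x => h1 x ^+ 2)).
  (* [h1^2 = h^4 du^2 / c^3], and [h < B]. *)
  move=> M0; have i1 := integrableZl _ (B ^+ 4 / c ^+ 3) (idu2 _ M0).
  apply: (@le_integrable _ _ R lebesgue_measure _ (measurable_itv _)
    (EFin \o (fun x => h1 x ^+ 2)) _ _ _ (i1 _)) => //.
    by apply/measurable_EFinP; apply: measurable_funTS; exact: measurable_funX.
  move=> x _; rewrite /= lee_fin.
  have c3 : 0 < c ^+ 3 by rewrite exprn_gt0.
  have /andP[hx0 hxB] := hB x.
  have B0 : 0 < B by exact: lt_trans hxB.
  have Bc0 : 0 <= B ^+ 4 / c ^+ 3 by rewrite divr_ge0 ?exprn_ge0 ?ltW.
  rewrite ger0_norm ?sqr_ge0// ger0_norm; last by apply: mulr_ge0; rewrite ?sqr_ge0.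
  rewrite du2 (_ : B ^+ 4 / c ^+ 3 * _ = B ^+ 4 / h x ^+ 4 * h1 x ^+ 2); last first.
    by field; rewrite hn0 gt_eqF.
  rewrite ler_peMl ?sqr_ge0// ler_pdivlMr ?exprn_gt0// mul1r.
  by rewrite lerXn2r ?nnegrE//; lra.
have etaf : eta = (fun x => h x - 1) by exact/funext.
have uf : u = (fun x => s + C / h x) by exact/funext.
have ceta : continuous eta.
  by rewrite etaf => z; apply: cvgB; [exact: ch|exact: cvg_cst].
have deta (x : R) : x != 0 -> is_derive x 1 eta (h1 x).
  move=> /hP[dh _]; rewrite etaf; apply: is_derive_eq.
  by rewrite subr0.
have weak_eta : distr_eq (distr_deriv (distr eta)) (distr h1).
  apply: (@distr_deriv_off_point _ _ _ 0) => // [x x0|M].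
    by split; [exact: deta|exact: ch1].
  by rewrite normr0 => M0; apply: integrable_of_sqr; [|exact: ih1].
have weak_u : distr_eq (distr_deriv (distr u)) (distr du).
  rewrite uf; apply: (@distr_deriv_off_point _ _ _ 0) => // [x x0|M].
    by split; [exact: ddu|exact: cdu].
  by rewrite normr0 => M0; apply: integrable_of_sqr; [|exact: idu2].
have weak_P : distr_eq (distr_deriv (distr P)) (distr Pd).
  apply: (@distr_deriv_off_point R P Pd 0 cP) => [x x0|M _]; last exact: icont.
  by split; [exact: dP|exact: cPd].
have weak_Pd : distr_eq (distr_deriv (distr Pd)) (distr Pdd).
  apply: (@distr_deriv_off_point R Pd Pdd 0 cPd) => [x x0|M].
    by split; [exact: dPd|exact: cPdd].
  by rewrite normr0 => /iPdd.
have ih1phi (phi : R -> R) : test_function phi ->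
    lebesgue_measure.-integrable setT (EFin \o (fun x => h1 x * phi x)).
  apply: integrable_mul_test_function => //.
  by exists 0 => M M0; apply: integrable_of_sqr; [|exact: ih1].
have distr0 (phi : R -> R) : distr (fun=> 0) phi = 0.
  rewrite /distr -[RHS](Rintegral_set0 lebesgue_measure (fun=> 0)).
  by under eq_Rintegral do rewrite mul0r; rewrite Rintegral_cst// mul0r Rintegral_set0.
exists h1, du; split.
- by split => //; exact: L2_loc_integrable.
- by split => //; exact: L2_loc_integrable.
- move=> phi tphi; rewrite distr0 /distr_add /distr_scale weak_eta//.
  have -> : distr_deriv (distr (fun x => (1 + eta x) * u x)) phi
      = distr (fun x => s * h1 x) phi.
    (* The definition of [u] makes the mass flux affine in [h], so its weak derivative is exactly
       [s * h1]. *)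
    have -> : (fun x => (1 + eta x) * u x) = (fun x => s * h x + C).
      by apply/funext => x; rewrite etaf uf; field; rewrite hn0.
    apply: (@distr_deriv_off_point _ _ _ 0) => //.
    + move=> x; apply: cvgD; last exact: cvg_cst.
      by apply: cvgM; [exact: cvg_cst|exact: ch].
    + move=> x x0; split; last by apply: cvgM; [exact: cvg_cst|exact: ch1].
      have [dh _] := hP x x0; apply: is_derive_eq.
      by rewrite /GRing.scale/=; ring.
    + move=> M; rewrite normr0 => M0.
      have i1 := integrable_of_sqr mh1 (ih1 _ M0).
      by apply: (eq_integrable _ _ _ _ (integrableZl _ s i1)).
  rewrite /distr.
  have -> : \int[lebesgue_measure]_x (s * h1 x * phi x)
      = s * \int[lebesgue_measure]_x (h1 x * phi x).
    rewrite -RintegralZl//; last exact: ih1phi.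
    by apply: eq_Rintegral => x _; rewrite mulrA.
  by rewrite mulNr addNr.
- move=> Q; have -> : Q = P.
    by apply/funext => x; rewrite /Q /P etaf uf cC; field; rewrite hn0.
  move=> phi0 tphi0; rewrite distr0 {1}/distr_deriv /distr_add /distr_scale.
  (* The outermost derivative is moved onto the test function: the bracket is tested against
     [phi0']. *)
  set phi := phi0^`()%classic.
  have tphi : test_function phi by exact: test_function_deriv.
  have tphi' := test_function_deriv tphi.
  have -> : distr_deriv (distr_deriv (distr P)) phi = distr Pdd phi.
    rewrite -(weak_Pd _ tphi); exact: (congr1 -%R (weak_P _ tphi')).
  (* [phi] is itself a derivative, so its integral vanishes, as the weak derivative of the constant
     [1] shows; this cancels the contribution of [K]. *)
  have int0 : \int[lebesgue_measure]_x phi x = 0.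
    have := @distr_deriv_off_point R (fun=> 1) (fun=> 0) 0 _ _ _ phi0 tphi0.
    rewrite distr0 /distr_deriv /distr => /(_ _ _ _)/eqP; rewrite oppr_eq0.
    under eq_Rintegral do rewrite mul1r.
    move=> H; apply/eqP; apply: H.
    + by move=> x; exact: cvg_cst.
    + by move=> x _; split; [exact: is_derive_cst|exact: cvg_cst].
    + by move=> M _; apply: icont => x; exact: cvg_cst.
  have jP : lebesgue_measure.-integrable setT (EFin \o (fun x => P x * phi x)).
    apply: integrable_mul_test_function => //; first exact: continuous_measurable_fun.
    by exists 0 => M _; exact: icont.
  have jPdd : lebesgue_measure.-integrable setT (EFin \o (fun x => Pdd x * phi x)).
    apply: integrable_mul_test_function => //.
      exact: (@measurable_continuous_off_point _ _ 0).
    by exists 0 => M /iPdd.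
  have jdu : lebesgue_measure.-integrable setT (EFin \o (fun x => du x ^+ 2 * phi x)).
    apply: integrable_mul_test_function => //; first exact: measurable_funX.
    by exists 0 => M /idu2.
  have jphi : lebesgue_measure.-integrable setT (EFin \o phi).
    have -> : phi = (fun x => 1 * phi x) by apply/funext => x; rewrite mul1r.
    apply: integrable_mul_test_function => //.
    by exists 0 => M _; apply: icont => x; exact: cvg_cst.
  have : distr Pdd phi = delta^-1 * (distr P phi
      + (3 / 2 * delta) * distr (fun x => du x ^+ 2) phi
      - K * \int[lebesgue_measure]_x phi x).
    have -> : distr Pdd phi = \int[lebesgue_measure]_x (delta^-1 *
        (P x * phi x + (3 / 2 * delta) * (du x ^+ 2 * phi x) - K * phi x)).
      by apply: eq_Rintegral => x _; rewrite /Pdd; field; rewrite gt_eqF.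
    have jK : lebesgue_measure.-integrable setT (EFin \o (fun x => K * phi x)).
      exact: (integrableZl measurableT K jphi).
    have j3 : lebesgue_measure.-integrable setT
        (EFin \o (fun x => 3 / 2 * delta * (du x ^+ 2 * phi x))).
      exact: (integrableZl measurableT (3 / 2 * delta) jdu).
    have jS := integrableD measurableT jP j3.
    have jB := integrableB measurableT jS jK.
    rewrite RintegralZl//; congr (_ * _).
    rewrite RintegralB//; congr (_ - _); last by rewrite RintegralZl.
    by rewrite RintegralD//; congr (_ + _); rewrite RintegralZl.
  rewrite int0 => ->.
  by field; rewrite gt_eqF.
Qed.

(** * The shock *)

(** For the relative speed [v = s - u], the shock relations say that [(1 + eta) v] and
    [eta + v^2 / 2] agree at both ends, and the Lax condition squares to [v_+^2 > 1 + eta_+] and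
    [v_-^2 < 1 + eta_-]. Since [C^2 = (1 + eta)^2 v^2] at either end, [C^2] lies strictly between
    the cubes of the two depths, and [c^3 / b^2] is [v^2]. *)
Lemma shock_algebra (R : realType) (s hm hp um up : R) :
  -1 < hp -> hp < hm -> up < um ->
  shock_relations s hm hp um up -> lax_condition s hm hp um up ->
  let C := mass_flux s hp up in let c := 1 + eta_star s hp up in
  [/\ c ^+ 3 = C ^+ 2, 0 < 1 + hp < c, c < 1 + hm,
      s + C / (1 + hm) = um /\ s + C / (1 + hp) = up &
      [/\ sigma_coef s hp up = (2 * (1 + hp) + c ^+ 3 / (1 + hp) ^+ 2 - 2) / c ^+ 3,
          2 * (1 + hm) + c ^+ 3 / (1 + hm) ^+ 2 = 2 * (1 + hp) + c ^+ 3 / (1 + hp) ^+ 2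
        & 1 + hm - 1 + c ^+ 3 / (2 * (1 + hm) ^+ 2)
          = 1 + hp - 1 + c ^+ 3 / (2 * (1 + hp) ^+ 2)]].
Proof.
move=> hp_gt hpm upm [sh1 sh2] /andP[lax1 lax2] C c.
have mass : (1 + hm) * (s - um) = (1 + hp) * (s - up).
  have : s * (hm - hp) = (1 + hm) * um - (1 + hp) * up.
    by rewrite [in LHS]sh1 divfK// subr_eq0 gt_eqF.
  by move=> H; apply/eqP; rewrite -subr_eq0; apply/eqP; nra.
have energy : (s - up) ^+ 2 - (s - um) ^+ 2 = 2 * (hm - hp).
  have : s * (um - up) = hm + 2^-1 * um ^+ 2 - hp - 2^-1 * up ^+ 2.
    by rewrite [in LHS]sh2 divfK// subr_eq0 gt_eqF.
  by move=> H; nra.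
have bp0 : 0 < 1 + hp by lra.
have bm0 : 0 < 1 + hm by lra.
set bp := 1 + hp in mass bp0 lax1 *; set bm := 1 + hm in mass bm0 lax2 *.
have sq_bp : Num.sqrt bp ^+ 2 = bp by rewrite sqr_sqrtr ?ltW.
have sq_bm : Num.sqrt bm ^+ 2 = bm by rewrite sqr_sqrtr ?ltW.
have vp0 : 0 < s - up by have := sqrtr_ge0 bp; lra.
(* The Lax condition bounds [s - um] only from above; its sign, needed for squaring, comes from mass
   conservation. *)
have vm0 : 0 < s - um by rewrite -(pmulr_rgt0 _ bm0) mass mulr_gt0.
have vp2 : bp < (s - up) ^+ 2.
  by rewrite -[ltLHS]sq_bp ltrXn2r ?sqrtr_ge0//; lra.
have vm2 : (s - um) ^+ 2 < bm.
  by rewrite -[ltRHS]sq_bm ltrXn2r ?(ltW vm0)//; lra.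
have CE : C = - (bp * (s - up)) by rewrite /C /mass_flux /bp; ring.
have C2 : C ^+ 2 = bp ^+ 2 * (s - up) ^+ 2 by rewrite CE; ring.
have C2' : C ^+ 2 = bm ^+ 2 * (s - um) ^+ 2 by rewrite CE -mass sqrrN exprMn.
have C20 : 0 < C ^+ 2 by rewrite C2 mulr_gt0 ?exprn_gt0.
have cE : c = (C ^+ 2) `^ (3^-1) by rewrite /c /eta_star addrC subrK.
have c0 : 0 < c by rewrite cE powR_gt0.
have c3 : c ^+ 3 = C ^+ 2.
  by rewrite cE -powR_mulrn ?powR_ge0// -powRrM mulVf// powRr1// ltW.
have bpc : bp < c.
  rewrite -(@ltr_pXn2r _ 3) ?nnegrE ?(ltW c0) ?(ltW bp0)// c3 C2 exprSr.
  by rewrite ltr_pM2l// exprn_gt0.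
have cbm : c < bm.
  rewrite -(@ltr_pXn2r _ 3) ?nnegrE ?(ltW c0) ?(ltW bm0)// c3 C2' [ltRHS]exprSr.
  by rewrite ltr_pM2l// exprn_gt0.
have vpE : c ^+ 3 / bp ^+ 2 = (s - up) ^+ 2.
  by rewrite c3 C2 mulrC mulKf// expf_neq0// gt_eqF.
have vmE : c ^+ 3 / bm ^+ 2 = (s - um) ^+ 2.
  by rewrite c3 C2' mulrC mulKf// expf_neq0// gt_eqF.
split => //; first by rewrite bp0.
  split.
    by rewrite CE -mass mulNr mulrAC divff ?gt_eqF// mul1r; ring.
  by rewrite CE mulNr mulrAC divff ?gt_eqF// mul1r; ring.
split.
- by rewrite vpE /sigma_coef -/bp -C2 c3; congr (_ / _); rewrite /bp; ring.
- by rewrite vpE vmE /bm /bp; lra.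
- have half b : c ^+ 3 / (2 * b ^+ 2) = 2^-1 * (c ^+ 3 / b ^+ 2).
    by rewrite invfM mulrCA.
  by rewrite !half vpE vmE /bm /bp; lra.
Qed.

(** * Limits of the slope and of the flux *)

(** [slope_sq] vanishes at [h = b] and is continuous there. A general filter covers both [-oo] and
    [+oo]. *)
Lemma slope_cvg0 (R : realType) (delta b c : R) (h : R -> R)
    (F : set_system R) (FF : Filter F) :
  delta != 0 -> b != 0 -> b ^+ 3 - c ^+ 3 != 0 -> h x @[x --> F] --> b ->
  - Num.sqrt (slope_sq delta b c (h x)) @[x --> F] --> (0 : R).
Proof.
move=> d0 b0 bc hb.
have -> : 0 = - Num.sqrt (slope_sq delta b c b).
  by rewrite /slope_sq subrr expr0n !mul0r sqrtr0 oppr0.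
apply: cvgN; apply: (@cvg_comp _ _ _ (fun x => slope_sq delta b c (h x)) Num.sqrt).
  apply: (@cvg_comp _ _ _ h (slope_sq delta b c)); first exact: hb.
  exact: is_derive1_continuous (is_derive_slope_sq _ _ _).
exact: sqrt_continuous.
Qed.

(** By [slope_sq_flux] the flux has absolute value [Num.sqrt (Q (b x) (h x))], where [Q] is
    continuous in [h] and [0] at [h = c]. As [b x] may jump at [0], the bound is the sum of the
    roots for the two end states. *)
Lemma flux_cvg0 (R : realType) (delta c bm bp : R) (h h1 b : R -> R) :
  0 < delta -> 0 < c -> 0 < bm -> 0 < bp -> {for 0, continuous h} -> h 0 = c ->
  (forall x, 0 < h x) -> (forall x, b x = bm \/ b x = bp) ->
  (forall x, h1 x ^+ 2 = slope_sq delta (b x) c (h x)) ->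
  (1 - c ^+ 3 / h x ^+ 3) * h1 x @[x --> (0 : R)] --> (0 : R).
Proof.
move=> d0 c0 bm0 bp0 ch h0 hpos bb h1E.
pose Q (b y : R) : R :=
  (y - b) ^+ 2 * (y - c ^+ 3 / b ^+ 2) * (y ^+ 3 - c ^+ 3) / (delta * y ^+ 4).
have Qcvg b' : Num.sqrt (Q b' (h x)) @[x --> (0 : R)] --> (0 : R).
  have Q0 : Num.sqrt (Q b' (h 0)) = 0.
    by rewrite /Q h0 subrr mulr0 mul0r sqrtr0.
  suff : Num.sqrt (Q b' (h x)) @[x --> (0 : R)] --> Num.sqrt (Q b' (h 0)).
    by rewrite Q0.
  apply: (@cvg_comp _ _ _ (fun x => Q b' (h x)) Num.sqrt); last exact: sqrt_continuous.
  apply: (@cvg_comp _ _ _ h (Q b') _ (nbhs (h 0))); first exact: ch.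
  have D0 : delta * h 0 ^+ 4 != 0 by rewrite h0 mulf_neq0 ?expf_neq0 ?gt_eqF.
  have cQ : {for h 0, continuous (Q b')}.
    rewrite /Q; eapply is_derive1_continuous; by typeclasses eauto.
  exact: cQ.
apply/norm_cvg0P.
have S0 : Num.sqrt (Q bm (h x)) + Num.sqrt (Q bp (h x)) @[x --> (0 : R)] --> (0 : R).
  suff : Num.sqrt (Q bm (h x)) + Num.sqrt (Q bp (h x)) @[x --> (0 : R)]
      --> (0 + 0 : R) by rewrite addr0.
  by apply: cvgD; exact: Qcvg.
apply: (squeeze_cvgr _ (cvg_cst _) S0).
near=> x; rewrite normr_ge0/=.
have -> : `|(1 - c ^+ 3 / h x ^+ 3) * h1 x| = Num.sqrt (Q (b x) (h x)).
  rewrite -sqrtr_sqr exprMn h1E slope_sq_flux//.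
  by case: (bb x) => ->.
by case: (bb x) => ->; rewrite ?lerDl ?lerDr ?sqrtr_ge0.
Unshelve. all: by end_near.
Qed.

(** * The half-orbits and the glued wave *)

Theorem theorem4p1 (R : realType) (delta s hm hp um up : R)
    (delta_gt0 : 0 < delta) (s_gt1 : 1 < s)
    (hp_gt : -1 < hp) (hp_lt_hm : hp < hm) (up_lt_um : up < um)
    (shock : shock_relations s hm hp um up)
    (lax : lax_condition s hm hp um up) :
  exists etaL etaR : R -> R,
    [/\ left_half_orbit delta s hm hp up etaL,
        right_half_orbit delta s hp up etaR &
        forall eta u : R -> R,
          (forall xi, xi < 0 -> eta xi = etaL xi) ->
          (forall xi, 0 < xi -> eta xi = etaR xi) ->
          eta 0 = eta_star s hp up ->
          (forall xi, u xi = s + mass_flux s hp up / (1 + eta xi)) ->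
          weakly_singular_traveling_wave delta s hm hp um up eta u].
Proof.
have := shock_algebra hp_gt hp_lt_hm up_lt_um shock lax.
set C := mass_flux s hp up; set c := 1 + eta_star s hp up.
move=> [c3 /andP[bp0 bpc] cbm [umE upE] [sigp sigpm momE]].
have c0 : 0 < c by exact: lt_trans bpc.
have bm0 : 0 < 1 + hm by exact: lt_trans cbm.
have bmc3 : (1 + hm) ^+ 3 - c ^+ 3 != 0 by rewrite subr_cube_neq0// gt_eqF.
have bpc3 : (1 + hp) ^+ 3 - c ^+ 3 != 0 by rewrite subr_cube_neq0// lt_eqF.
(* [sigma] is defined from the right state; the equality of [2 b + c^3 / b^2] at both ends lets the
   left half-orbit obey the same equation. *)
have sigm : sigma_coef s hp up
    = (2 * (1 + hm) + c ^+ 3 / (1 + hm) ^+ 2 - 2) / c ^+ 3 by rewrite sigpm.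
have dn0 : delta != 0 by rewrite gt_eqF.
have bmn0 : 1 + hm != 0 by rewrite gt_eqF.
have bpn0 : 1 + hp != 0 by rewrite gt_eqF.
have cbm0 : 0 < c < 1 + hm by rewrite c0.
have bpc0 : 0 < 1 + hp < c by rewrite bp0.
have [hL [Lr LW Ld L0 Loo]] := left_profile_exists delta_gt0 cbm0.
have [hR [Rr RW Rd R0 Roo]] := right_profile_exists delta_gt0 bpc0.
have subK (h : R -> R) (x : R) : 1 + (h x - 1) = h x by ring.
have starE : eta_star s hp up = c - 1 by rewrite /c; ring.
have dsub (h : R -> R) (x l : R) : is_derive x 1 h l ->
    is_derive x 1 (fun x => h x - 1) l.
  by move=> dh; have := is_deriveB dh (is_derive_cst (1 : R) x 1); rewrite subr0.
have [||LC2 Leq Ld1] := @profile_equation_of_slope R delta s hp up (1 + hm) c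
  (fun x => hL x - 1) [set x | x < 0] _ delta_gt0 bm0 c0 c3 sigm.
- exact: open_lt.
- move=> x x0; have /andP[cx _] := Lr x x0; rewrite subK; split.
  + exact: lt_trans cx.
  + by rewrite gt_eqF.
  + exact: LW.
  + by apply: dsub; exact: Ld.
have [||RC2 Req Rd1] := @profile_equation_of_slope R delta s hp up (1 + hp) c
  (fun x => hR x - 1) [set x | 0 < x] _ delta_gt0 bp0 c0 c3 sigp.
- exact: open_gt.
- move=> x x0; have /andP[bx xc] := Rr x x0; rewrite subK; split.
  + exact: lt_trans bx.
  + by rewrite lt_eqF.
  + exact: RW.
  + by apply: dsub; exact: Rd.
have csub (h : R -> R) (F : set_system R) (FF : Filter F) (l : R) :
    h x @[x --> F] --> l -> h x - 1 @[x --> F] --> l - 1.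
  by move=> hl; apply: cvgB; [exact: hl|exact: cvg_cst].
exists (fun x => hL x - 1), (fun x => hR x - 1); split.
- split => //.
  + by move=> x x0; have := Lr x x0; rewrite starE; lra.
  + by move=> x x0; rewrite Ld1// subK oppr_lt0 sqrtr_gt0; exact: LW.
  + by rewrite (_ : hm = 1 + hm - 1); [exact: csub|ring].
  + have S : - Num.sqrt (slope_sq delta (1 + hm) c (hL x)) @[x --> -oo] --> (0 : R).
      exact: slope_cvg0.
    apply: cvg_trans S.
    apply: near_eq_cvg; near=> x.
    have x0 : x < 0 by near: x; apply: nbhs_ninfty_lt; exact: num_real.
    by rewrite Ld1// subK.
  + by rewrite starE; exact: csub.
- split => //.
  + by move=> x x0; have := Rr x x0; rewrite starE; lra.
  + by move=> x x0; rewrite Rd1// subK oppr_lt0 sqrtr_gt0; exact: RW.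
  + by rewrite (_ : hp = 1 + hp - 1); [exact: csub|ring].
  + have S : - Num.sqrt (slope_sq delta (1 + hp) c (hR x)) @[x --> +oo] --> (0 : R).
      exact: slope_cvg0.
    apply: cvg_trans S.
    apply: near_eq_cvg; near=> x.
    have x0 : 0 < x by near: x; apply: nbhs_pinfty_gt; exact: num_real.
    by rewrite Rd1// subK.
  + by rewrite starE; exact: csub.
move=> eta u etaL etaR eta0 uE.
pose h (x : R) : R := 1 + eta x.
have hLE (x : R) : x < 0 -> h x = hL x by move=> /etaL; rewrite /h => ->; rewrite subK.
have hRE (x : R) : 0 < x -> h x = hR x by move=> /etaR; rewrite /h => ->; rewrite subK.
have h0E : h 0 = c by rewrite /h eta0.
pose b (x : R) : R := if x < 0 then 1 + hm else 1 + hp.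
have bL (x : R) : x < 0 -> b x = 1 + hm by rewrite /b => ->.
have bR (x : R) : 0 < x -> b x = 1 + hp by rewrite /b => x0; rewrite ltNge (ltW x0).
have b0 (x : R) : 0 < b x by rewrite /b; case: ifP.
pose h1 (x : R) : R := - Num.sqrt (slope_sq delta (b x) c (h x)).
pose h2 (x : R) : R := slope_sq' delta (b x) c (h x) / 2.
have nearL (x : R) : x < 0 -> \forall y \near x, y < 0 by exact: lt_nbhsl.
have nearR (x : R) : 0 < x -> \forall y \near x, 0 < y by exact: lt_nbhsr.
have hB (x : R) : 0 < h x < 1 + hm.
  case: (ltgtP x 0) => [x0|x0|->].
  - by rewrite hLE//; have := Lr x x0; lra.
  - by rewrite hRE//; have := Rr x x0; lra.
  - by rewrite h0E c0.
have hc (x : R) : x != 0 -> h x != c.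
  case: (ltgtP x 0) => // x0 _.
  - by rewrite hLE//; have /andP[? _] := Lr x x0; rewrite gt_eqF.
  - by rewrite hRE//; have /andP[_ ?] := Rr x x0; rewrite lt_eqF.
have W0 (x : R) : x != 0 -> 0 < slope_sq delta (b x) c (h x).
  case: (ltgtP x 0) => // x0 _.
  - by rewrite hLE// bL//; exact: LW.
  - by rewrite hRE// bR//; exact: RW.
have dh (x : R) : x != 0 -> is_derive x 1 h (h1 x).
  case: (ltgtP x 0) => // x0 _.
  - apply: (@near_eq_is_derive _ _ _ hL); last by rewrite /h1 hLE// bL//; exact: Ld.
    by apply: filterS (nearL x x0) => y /hLE ->.
  - apply: (@near_eq_is_derive _ _ _ hR); last by rewrite /h1 hRE// bR//; exact: Rd.
    by apply: filterS (nearR x x0) => y /hRE ->.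
have dh1 (x : R) : x != 0 -> is_derive x 1 h1 (h2 x).
  move=> x0.
  (* Away from [0] the end state is locally constant, so it is frozen at [b x] before
     differentiating. *)
  apply: (@near_eq_is_derive _ _ _
    (fun y => - Num.sqrt (slope_sq delta (b x) c (h y)))).
    case: (ltgtP x 0) x0 => // x0 _.
    - by apply: filterS (nearL x x0) => y y0; rewrite /h1 !bL.
    - by apply: filterS (nearR x x0) => y y0; rewrite /h1 !bR.
  have dW : is_derive (h x) 1 (slope_sq delta (b x) c) (slope_sq' delta (b x) c (h x)).
    by apply: is_derive_slope_sq; rewrite ?subr_cube_neq0 ?hc// gt_eqF.
  exact: (is_derive_slope (dh x x0) (W0 x x0) dW).
have h1sq (x : R) : h1 x ^+ 2 = slope_sq delta (b x) c (h x).
  (* Division by zero gives [slope_sq] the value [0] at [h = c], so nonnegativity extends to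
     [x = 0]. *)
  rewrite sqrrN sqr_sqrtr//; have [->|/W0/ltW//] := eqVneq x 0.
  by rewrite h0E /slope_sq subrr mulr0 invr0 mulr0.
have glue (g l : R -> R) (F : set_system R) (FF : Filter F) (v : R) :
    (\forall x \near F, g x = l x) -> l x @[x --> F] --> v -> g x @[x --> F] --> v.
  move=> gl; apply: cvg_trans; apply: near_eq_cvg.
  by apply: filterS gl => x ->.
have ch : continuous h.
  move=> x; have [->|x0] := eqVneq x 0; last exact: is_derive1_continuous (dh x x0).
  apply/left_right_continuousP; rewrite h0E; split.
  - apply: glue L0; near=> y; apply: hLE; near: y; exact: nbhs_left_lt.
  - apply: glue R0; near=> y; apply: hRE; near: y; exact: nbhs_right_gt.
have hoo : h x @[x --> -oo] --> 1 + hm.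
  apply: glue Loo; near=> x; apply: hLE; near: x; apply: nbhs_ninfty_lt; exact: num_real.
have hoo' : h x @[x --> +oo] --> 1 + hp.
  apply: glue Roo; near=> x; apply: hRE; near: x; apply: nbhs_pinfty_gt; exact: num_real.
have hn0 (x : R) : h x != 0 by rewrite gt_eqF//; case/andP: (hB x).
have etaf : eta = (fun x => h x - 1) by apply/funext => x; rewrite /h; ring.
have uf : u = (fun x => s + C / h x) by apply/funext.
have cu (F : set_system R) (FF : Filter F) (l : R) : l != 0 ->
    h x @[x --> F] --> l -> u x @[x --> F] --> s + C / l.
  move=> l0 hl; rewrite uf; apply: cvgD; first exact: cvg_cst.
  by apply: cvgM; [exact: cvg_cst|exact: cvgV].
split.
- split => x; first by rewrite etaf; apply: csub; exact: ch.
  by rewrite /continuous_at uE; apply: (cu _ _ (h x)); [exact: hn0|exact: ch].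
- split.
  + by rewrite etaf (_ : hm = 1 + hm - 1); [exact: csub|ring].
  + by rewrite etaf (_ : hp = 1 + hp - 1); [exact: csub|ring].
  + by rewrite -umE; apply: cu.
  + by rewrite -upE; apply: cu.
apply: (@weak_solution_of_profile R delta s C c (1 + hm - 1 + c ^+ 3 / (2 * (1 + hm) ^+ 2))
  (1 + hm) h h1 h2) => //.
- by move=> x x0; split; [exact: dh|exact: dh1].
- move=> x x0; rewrite h1sq.
  (* [P] takes the same value at both end states by the shock relations, so one constant serves on
     both sides of [0]. *)
  have -> : 1 + hm - 1 + c ^+ 3 / (2 * (1 + hm) ^+ 2)
      = b x - 1 + c ^+ 3 / (2 * b x ^+ 2) by rewrite /b; case: ifP.
  by rewrite slope_sq_momentum ?hc//; case/andP: (hB x).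
- move=> x; have [->|x0] := eqVneq x 0.
    rewrite /continuous_at h0E divff ?subrr ?mul0r ?expf_neq0 ?gt_eqF//.
    apply: (@flux_cvg0 R delta c (1 + hm) (1 + hp) h h1 b) => //.
    + exact: ch.
    + by move=> y; case/andP: (hB y).
    + by move=> y; rewrite /b; case: ifP; [left|right].
  apply: cvgM; last exact: is_derive1_continuous (dh1 x x0).
  apply: cvgB; first exact: cvg_cst.
  apply: cvgM; first exact: cvg_cst.
  apply: cvgV; first by rewrite expf_neq0.
  by apply: (@cvg_comp _ _ _ h (fun y => y ^+ 3) _ (nbhs (h x)));
    [exact: ch|exact: exprn_continuous].
- by move=> x; rewrite etaf.
Unshelve. all: by end_near.
Qed.
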